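(* Consider the system $$\dot x=h(t/\alpha)\,m(t)m^\top(t)\,x,\qquad x\in\mathbb{R}^n, \tag{I}$$ where $\alpha>0$ is a constant. Suppose there are positive constants $T,\tilde c,\underline\alpha,\bar\alpha$ such that: - $h:\mathbb{R}\to[-\bar\alpha,0]$ is continuous with a bounded first derivative and $\int_{t-T}^th(r)\,dr\le-\underline\alpha$ for all $t\in\mathbb{R}$; - $m:\mathbb{R}\to\mathbb{R}^n$ is continuous, $|m(t)|=1$ for all $t\in\mathbb{R}$, and $\underline\alpha I\le\int_t^{t+\tilde c}m(r)m^\top(r)\,dr\le\bar\alpha I$ for all $t\in\mathbb{R}$. Set $$\kappa=\frac{\tilde c}{2}+\frac{\bar\alpha^2\tilde c^4}{2\underline\alpha}+\tilde c^2,\qquad P(t,\tau)=\kappa I-\tau\int_{t-\tilde c}^t\int_s^tm(l)m^\top(l)\,dl\,ds,\qquad V(x,t,\tau)=x^\top P(t,\tau)x,$$ and $c_b=\dfrac{\underline\alpha^2}{2(\kappa+\tilde c^2\bar\alpha)}$. Then for any constant $\alpha>0$ with $\alpha\ge 2T\sup\{|h'(r)|:r\in\mathbb{R}\}/c_b$, the function $$V^\sharp_\alpha(x,t):=\exp\left(-\frac{\alpha\,\underline\alpha}{2T(\kappa+\tilde c^2\bar\alpha)}\int_{\frac t\alpha-T}^{\frac t\alpha}\int_s^{\frac t\alpha}h(l)\,dl\,ds\right)V(x,t,h(t/\alpha))$$ is a Lyapunov function for (I). Hence, (I) is UGAS for all constants $\alpha>0$ with $\alpha\ge2T\sup\{|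h'(r)|:r\in\mathbb{R}\}/c_b$.
   Context: $|\cdot|$ is the Euclidean norm; $I$ is the $n\times n$ identity matrix; for matrices, $A\le B$ means $B-A$ is positive semi-definite. Note that the constants $\underline\alpha,\bar\alpha$ are distinct from the time-scale constant $\alpha$. Subscripts on $W$ below denote partial gradients; $C^1$ means continuously differentiable. $\mathcal{K}_\infty$: continuous, strictly increasing, unbounded functions $\rho:[0,\infty)\to[0,\infty)$ with $\rho(0)=0$. $\mathcal{KL}$: continuous functions $\beta:[0,\infty)\times[0,\infty)\to[0,\infty)$ such that $\beta(\cdot,t)\in\mathcal{K}_\infty$ for each $t\ge0$, $\beta(s,\cdot)$ is non-increasing for each $s\ge0$, and $\beta(s,t)\to0$ as $t\to+\infty$ for each $s\ge 0$. A continuous function $\rho:[0,\infty)\to[0,\infty)$ is positive definite if it is zero only at zero. For a system $\dot x=F(x,t)$ on $\mathbb{R}^n$, $t\ge0$, with trajectories $\phi(t;t_o,x_o)$ (value $x_o$ at time $t_o$): - It is UGAS (uniformly globally asymptotically stable) if there is $\beta\in\mathcal{KL}$ with $|\phi(t;t_o,x_o)|\le\beta(|x_o|,t-t_o)$ for all $x_o\in\mathbb{R}^n$, $t_o\ge0$, $t\ge t_o$. - A Lyapunov function for it is a $C^1$ function $W:\mathbb{R}^n\times[0,\infty)\to[0,\infty)$ for which there are $\alpha_1,\alpha_2\in\mathcal{K}_\infty$ and a positive definite $\alpha_3$ such that $\alpha_1(|x|)\le W(x,t)\le\alpha_2(|x|)$ and $W_t(x,t)+W_x(x,t)F(x,t)\le-\alpha_3(|x|)$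 for all $t\ge0$, $x\in\mathbb{R}^n$.
   Formalization: The first derivative of h is additionally assumed continuous for the claim that V♯ is C¹ (hence a Lyapunov function), which fails otherwise; existence of the partial gradients, all Lyapunov inequalities and UGAS are proved with h' merely bounded. *)

(* Defs.v *)
From HB Require Import structures.
From mathcomp Require Import all_boot all_order all_algebra.
From mathcomp Require Import all_classical all_reals all_analysis.

Set Implicit Arguments.
Unset Strict Implicit.
Unset Printing Implicit Defensive.

Import Order.TTheory GRing.Theory Num.Theory.
Import numFieldNormedType.Exports.

Local Open Scope classical_set_scope.
Local Open Scope ring_scope.

(* Only the topology of 'cV[R]_n is taken from the library; its canonical norm
   is the max-norm, so the Euclidean one has to be introduced. *)
Definition enorm (R : realType) n (x : 'cV[R]_n) : R :=
  Num.sqrt (\sum_i x i ord0 ^+ 2).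

Definition psdmx (R : realType) n (A : 'M[R]_n) : Prop :=
  A^T = A /\ forall x : 'cV[R]_n, 0 <= (x^T *m A *m x) ord0 ord0.

Definition loewner_le (R : realType) n (A B : 'M[R]_n) : Prop := psdmx (B - A).

Definition mxintegral (R : realType) p q (a b : R) (M : R -> 'M[R]_(p, q)) :
    'M[R]_(p, q) :=
  \matrix_(i, j) \int[lebesgue_measure]_(r in `[a, b]) M r i j.

(* Functions on [0, +oo[ are represented by total functions on R, about which
   nothing is assumed on the negative half-line.  Nonnegativity on [0, +oo[
   follows from rho 0 = 0 and monotonicity. *)
Definition class_Kinfty (R : realType) (rho : R -> R) : Prop :=
  [/\ {within `[0, +oo[, continuous rho},
      forall s t, 0 <= s -> s < t -> rho s < rho t,
      forall M, exists2 s, 0 <= s & M < rho s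
    & rho 0 = 0].

Definition class_KL (R : realType) (beta : R -> R -> R) : Prop :=
  [/\ {within [set p : R * R | 0 <= p.1 /\ 0 <= p.2],
        continuous (fun p : R * R => beta p.1 p.2)},
      forall t, 0 <= t -> class_Kinfty (beta ^~ t),
      forall s t1 t2, 0 <= s -> 0 <= t1 -> t1 <= t2 -> beta s t2 <= beta s t1
    & forall s, 0 <= s -> beta s t @[t --> +oo] --> 0].

Definition positive_definite (R : realType) (rho : R -> R) : Prop :=
  [/\ {within `[0, +oo[, continuous rho},
      forall s, 0 <= s -> 0 <= rho s
    & forall s, 0 <= s -> (rho s = 0 <-> s = 0)].

(* Filtered difference quotients of f at t along times staying in A; they give
   the usual derivative in the interior of A and one-sided ones at endpoints. *)
Definition quotients_within (R : realType) (U : normedModType R) (A : set R)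
    (f : R -> U) (t : R) : set_system U :=
  (fun s : R => s^-1 *: (f (t + s) - f t)) @
    within (fun s => A (t + s)) (0 : R)^'.

Definition trajectory (R : realType) n (F : 'cV[R]_n -> R -> 'cV[R]_n)
    (A : set R) (to : R) (xo : 'cV[R]_n) (phi : R -> 'cV[R]_n) : Prop :=
  phi to = xo /\
  forall t, A t -> quotients_within A phi t --> F (phi t) t.

(* The notation phi(t; t_o, x_o) for all t >= t_o presupposes that trajectories
   exist on [t_o, +oo[: this is the first conjunct.  The bound is required of
   every trajectory, including those only defined up to time t. *)
Definition UGAS (R : realType) n (F : 'cV[R]_n -> R -> 'cV[R]_n) : Prop :=
  exists2 beta : R -> R -> R, class_KL beta &
    forall (xo : 'cV[R]_n) (to : R), 0 <= to ->
      (exists phi, trajectory F `[to, +oo[ to xo phi) /\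
      (forall t phi, to <= t -> trajectory F `[to, t] to xo phi ->
         enorm (phi t) <= beta (enorm xo) (t - to)).

Section TimeVaryingFunctions.
Context (R : realType) (n : nat).
Implicit Types (W : 'cV[R]_n -> R -> R) (F : 'cV[R]_n -> R -> 'cV[R]_n).

(* The domain of W is R^n x [0, +oo[, so that the time derivative is the right
   derivative at t = 0. *)
Definition gradt W (x : 'cV[R]_n) (t : R) : R :=
  lim (quotients_within `[0, +oo[ (W x : R -> R^o) t).

Definition gradx W (x : 'cV[R]_n) (t : R) : 'rV[R]_n :=
  \row_i 'D_(delta_mx i ord0) (W ^~ t) x.

Definition has_partials W : Prop :=
  forall x t, 0 <= t ->
    cvg (quotients_within `[0, +oo[ (W x : R -> R^o) t) /\
    forall i, derivable (W ^~ t) x (delta_mx i ord0).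

Definition C1 W : Prop :=
  [/\ has_partials W,
      {within [set p : 'cV[R]_n * R | 0 <= p.2],
        continuous (fun p : 'cV[R]_n * R => gradt W p.1 p.2)}
    & {within [set p : 'cV[R]_n * R | 0 <= p.2],
        continuous (fun p : 'cV[R]_n * R => gradx W p.1 p.2)}].

Definition lyapunov_estimates F W : Prop :=
  (forall x t, 0 <= t -> 0 <= W x t) /\
  exists alpha1 alpha2 alpha3 : R -> R,
    [/\ class_Kinfty alpha1, class_Kinfty alpha2, positive_definite alpha3
      & forall x t, 0 <= t ->
          alpha1 (enorm x) <= W x t <= alpha2 (enorm x) /\
          gradt W x t + (gradx W x t *m F x t) ord0 ord0 <= - alpha3 (enorm x)].

Definition lyapunov_function F W : Prop := C1 W /\ lyapunov_estimates F W.

End TimeVaryingFunctions.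

Section Construction.
Context (R : realType) (n : nat).
(* T, c, al, au stand for T, c-tilde, alpha-underbar, alpha-bar. *)
Variables (T c al au : R) (h : R -> R) (m : R -> 'cV[R]_n).

Definition sys_field (alpha : R) (x : 'cV[R]_n) (t : R) : 'cV[R]_n :=
  h (t / alpha) *: (m t *m (m t)^T *m x).

Definition kappa : R :=
  c / 2 + (au ^+ 2 * c ^+ 4) / (2 * al) + c ^+ 2.

Definition Pmx (t tau : R) : 'M[R]_n :=
  kappa%:M - tau *: mxintegral (t - c) t (fun s =>
                      mxintegral s t (fun l => m l *m (m l)^T)).

Definition Vfun (x : 'cV[R]_n) (t tau : R) : R :=
  (x^T *m Pmx t tau *m x) ord0 ord0.

Definition cb : R := al ^+ 2 / (2 * (kappa + c ^+ 2 * au)).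

Definition Vsharp (alpha : R) (x : 'cV[R]_n) (t : R) : R :=
  expR (- (alpha * al / (2 * T * (kappa + c ^+ 2 * au)) *
           \int[lebesgue_measure]_(s in `[t / alpha - T, t / alpha])
             \int[lebesgue_measure]_(l in `[s, t / alpha]) h l)) *
  Vfun x t (h (t / alpha)).

End Construction.

(* Main.v *)
(* The matrix [P] solves the problem with frozen [tau = h (t / alpha) <= 0]: since
   [M = int_{t-c}^t int_s^t m m^T] has derivative [c m m^T - int_{t-c}^t m m^T],
   differentiating [V] makes [tau x^T (int_{t-c}^t m m^T) x <= al tau |x|^2] appear,
   while [kappa] is large enough for [2 kappa tau (m.x)^2] to absorb all the
   terms in [m.x], the cross term [x^T M m] being handled by AM-GM.  This leaves
   [V' <= (al / 2) tau |x|^2 + |h'| c^2 |x|^2 / (2 alpha)].  Where [h] vanishes,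
   the first term is useless; the exponential weight trades it for its average
   over a window, because the logarithmic derivative of the weight is a multiple of
   [int_{t/alpha-T}^{t/alpha} h - T tau].  Its [tau] part is compensated by the
   decay of [V], its integral part is at most [- al], and the [h'] term is small
   for large [alpha], so that [Vsharp' <= - (cb / (2 T)) Vsharp].

   [Vsharp] is a quadratic form [sum_ij Q_ij(t) x_i x_j] with differentiable
   coefficients, and lies between two multiples of [|x|^2]: the decay is
   exponential, whence UGAS.  Trajectories exist by Picard iteration. *)

Require Import Defs.
From HB Require Import structures.
From mathcomp Require Import all_boot all_order all_algebra.
From mathcomp Require Import all_classical all_reals all_analysis.
From mathcomp Require Import ring lra.

Set Implicit Arguments.
Unset Strict Implicit.
Unset Printing Implicit Defensive.
Import Order.TTheory GRing.Theory Num.Theory.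
Import numFieldNormedType.Exports.
Local Open Scope classical_set_scope.
Local Open Scope ring_scope.

(** * Primitives and one-sided difference quotients *)

Section Primitives.
Context {R : realType}.
Implicit Types (f g G : R -> R) (a b t : R).
Notation mu := (@lebesgue_measure R).

Lemma continuous_integrable_itv g a b : continuous g ->
  mu.-integrable `[a, b] (EFin \o g).
Proof.
move=> cg; apply: continuous_compact_integrable; first exact: segment_compact.
exact: continuous_subspaceT.
Qed.

Lemma Rintegral_itv_rev g a b : b <= a -> \int[mu]_(r in `[a, b]) g r = 0.
Proof.
rewrite le_eqVlt => /predU1P[->|ba]; first by rewrite set_itv1 Rintegral_set1.
by rewrite set_itv_ge ?Rintegral_set0// bnd_simp -ltNge.
Qed.

Lemma Rintegral_itv_chasles g a x b : continuous g -> a <= x -> x <= b ->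
  \int[mu]_(r in `[a, b]) g r =
  \int[mu]_(r in `[a, x]) g r + \int[mu]_(r in `[x, b]) g r.
Proof.
move=> cg ax xb; apply/eqP; rewrite addrC -subr_eq; apply/eqP.
rewrite Rintegral_itvB ?bnd_simp//; last exact: continuous_integrable_itv.
rewrite Rintegral_itv_obnd_cbnd//.
apply: integrableS (continuous_integrable_itv x b cg) => //.
exact: subset_itv_oc_cc.
Qed.

(** An integral over [[a, b]] is one over a set, hence 0 when [b < a]; this is why the second clause
    asks for [a <= b]. Keeping both clauses together allows an integral with moving endpoints to be
    evaluated and differentiated through the same [G]. *)
Definition primitive_of g G : Prop :=
  (forall t, is_derive t 1 G (g t)) /\
  forall a b, a <= b -> \int[mu]_(r in `[a, b]) g r = G b - G a.

Lemma primitive_exists g : continuous g -> exists G, primitive_of g G.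
Proof.
move=> cg.
(* At most one of the two integrals is nonzero: the difference is the oriented integral from 0 to
   [t]. *)
pose G t := \int[mu]_(r in `[0, t]) g r - \int[mu]_(r in `[t, 0]) g r.
have Gint a b : a <= b -> \int[mu]_(r in `[a, b]) g r = G b - G a.
  move=> ab; rewrite /G; have [a0|a0] := leP 0 a.
    rewrite (Rintegral_itv_chasles cg a0 ab) (Rintegral_itv_rev g a0).
    rewrite (Rintegral_itv_rev g (le_trans a0 ab)); ring.
  have [b0|b0] := leP 0 b.
    rewrite (Rintegral_itv_chasles cg (ltW a0) b0) (Rintegral_itv_rev g b0).
    rewrite (Rintegral_itv_rev g (ltW a0)); ring.
  rewrite (Rintegral_itv_chasles cg ab (ltW b0)) (Rintegral_itv_rev g (ltW b0)).
  rewrite (Rintegral_itv_rev g (ltW a0)); ring.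
exists G; split => // t.
(* Starting the integral at [t - 1] makes [t] an interior point for the fundamental theorem; near
   [t], [F] and [G] differ by the constant [G (t - 1)]. *)
pose F x := \int[mu]_(r in `[t - 1, x]) g r.
have t1 : t - 1 < t by rewrite ltrBlDr ltrDl.
have [dF F't] : derivable F t 1 /\ derive1 F t = g t.
  apply: (@continuous_FTC1_closed _ _ _ _ (t + 1)) => //.
  - by rewrite ltrDl.
  - exact: continuous_integrable_itv.
  - exact: cg.
have isF : is_derive t 1 F (g t) by split => //; rewrite -F't derive1E.
apply: (@near_eq_is_derive R R R (fun x => F x + G (t - 1))).
- have tin : t \in `]t - 1, +oo[ by rewrite in_itv/= t1.
  near=> s; rewrite /F Gint ?subrK//.
  have : s \in `]t - 1, +oo[ by near: s; exact: near_in_itvoy tin.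
  by rewrite in_itv/= andbT => /ltW.
- by have := is_deriveD isF (is_derive_cst (G (t - 1)) t 1); rewrite addr0.
Unshelve. all: by end_near. Qed.

(** Mean value theorem for [g - f]. It plays the role of monotonicity of the integral below, once
    integrals are written as increments of primitives. *)
Lemma le_of_derive_le f df g dg a b :
  (forall t, is_derive t 1 f (df t)) -> (forall t, is_derive t 1 g (dg t)) ->
  a <= b -> (forall t, a <= t -> t <= b -> df t <= dg t) ->
  f b - f a <= g b - g a.
Proof.
move=> fd gd ab le_df.
have hd t : is_derive t 1 (g - f) (dg t - df t) by exact: is_deriveB.
have [|c /[!in_itv]/= /andP[ac cb] E] := @MVT_segment R (g - f) _ a b ab
    (fun x _ => hd x).
  apply: continuous_subspaceT => x.
  by apply: differentiable_continuous; apply/derivable1_diffP/ex_derive.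
rewrite -subr_ge0 (_ : _ - _ = (g - f) b - (g - f) a); last first.
  by rewrite !fctE; ring.
by rewrite E mulr_ge0 ?subr_ge0 ?le_df.
Qed.

Lemma is_derive_continuous f df :
  (forall t, is_derive t 1 f (df t)) -> continuous f.
Proof.
by move=> fd x; apply: differentiable_continuous; apply/derivable1_diffP/ex_derive.
Qed.

End Primitives.

Section QuotientsWithin.
Context {R : realType}.
Implicit Types (A : set R) (t : R).

Lemma is_derive_quotients_within (U : normedModType R) A (f : R -> U) t d :
  is_derive t 1 f d -> quotients_within A f t --> d.
Proof.
move=> [df <-]; apply: cvg_within_filter.
rewrite (_ : (fun s => _) =
    (fun s : R => s^-1 *: ((f \o shift t) (s *: 1) - f t))); first exact: df.
by apply/funext => s /=; rewrite [s%:A]mulr1 (addrC s t).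
Qed.

(** Properness makes the limit of the quotients unique. Asking for times on the right of [t] only
    covers the endpoint 0 of [[0, +oo[]. *)
Lemma proper_within_dnbhs_right A t :
  (\forall s \near (0 : R)^'+, A (t + s)) ->
  ProperFilter (within (fun s => A (t + s)) (0 : R)^').
Proof.
move=> nA; split; last exact: within_filter.
move=> H; have H' : \forall s \near (0 : R)^'+, A (t + s) -> False.
  rewrite near_withinE; move: H; rewrite /within/= near_withinE => H.
  by apply: filterS H => s sP s0; apply: sP; rewrite gt_eqF.
by have [s [As nAs]] := filter_ex (filterI nA H'); exact: nAs.
Qed.

Lemma lim_quotients_within (U : normedModType R) A (f : R -> U) t d :
  (\forall s \near (0 : R)^'+, A (t + s)) ->
  is_derive t 1 f d -> lim (quotients_within A f t) = d.
Proof.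
move=> nA fd; have ? := proper_within_dnbhs_right nA.
apply: cvg_lim; first exact: norm_hausdorff.
exact: is_derive_quotients_within.
Qed.

Lemma near_right_itvcy t : 0 <= t ->
  \forall s \near (0 : R)^'+, [set` `[0, +oo[] (t + s).
Proof.
move=> t0; apply: filterS (nbhs_right_ge 0) => s s0.
by rewrite /= in_itv/= andbT addr_ge0.
Qed.

End QuotientsWithin.

(** * Quadratic forms with time-varying coefficients *)

Lemma cvg_funsum (R : realType) (T : Type) (F : set_system T) {FF : Filter F}
    n (h : 'I_n -> T -> R) (l : 'I_n -> R) :
  (forall i, h i @ F --> l i) ->
  (fun x => \sum_(i < n) h i x) @ F --> \sum_(i < n) l i.
Proof. by move=> hl; apply: cvg_big => //; exact: add_continuous. Qed.

Lemma cvg_mx (R : realType) (T : Type) (F : set_system T) {FF : Filter F}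
    p q (f : T -> 'M[R]_(p, q)) (l : 'M[R]_(p, q)) :
  (forall i j, (fun x => f x i j) @ F --> l i j) -> f @ F --> l.
Proof.
move=> fl; apply/cvg_ballP => e e0.
have H : \forall x \near F, forall i j, ball (l i j) e (f x i j).
  apply: filter_forall => i; apply: filter_forall => j.
  by have /cvg_ballP := fl i j; exact.
by apply: filterS H => x.
Qed.

Section PointwiseDerivatives.
Context {R : realType} {V : normedModType R}.
Implicit Types (f g : V -> R) (x v : V).

Lemma is_derive_funD f g x v df dg :
  is_derive x v f df -> is_derive x v g dg ->
  is_derive x v (fun y => f y + g y) (df + dg).
Proof. by move=> ? ?; exact: is_deriveD. Qed.

Lemma is_derive_funM f g x v df dg :
  is_derive x v f df -> is_derive x v g dg ->
  is_derive x v (fun y => f y * g y) (df * g x + f x * dg).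
Proof.
move=> fd gd; apply: is_derive_eq (is_deriveM fd gd) _.
by rewrite addrC mulrC.
Qed.

Lemma is_derive_funMl (k : R) f x v df :
  is_derive x v f df -> is_derive x v (fun y => k * f y) (k * df).
Proof. by move=> ?; exact: is_deriveZ. Qed.

Lemma is_derive_funsum n (h : 'I_n -> V -> R) x v (dh : 'I_n -> R) :
  (forall i, is_derive x v (h i) (dh i)) ->
  is_derive x v (fun y => \sum_(i < n) h i y) (\sum_(i < n) dh i).
Proof.
move=> hd; have := is_derive_sum hd.
by rewrite (_ : \sum_(i < n) h i = fun y => \sum_(i < n) h i y)//;
  apply/funext => y; rewrite fct_sumE.
Qed.

End PointwiseDerivatives.

Lemma cvg_coord (R : realType) (T : Type) (F : set_system T) {FF : Filter F} n
    (f : T -> 'cV[R]_n) (l : 'cV[R]_n) i :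
  f @ F --> l -> f p i ord0 @[p --> F] --> l i ord0.
Proof.
move=> fl; apply: (continuous_cvg _ (h := fun A : 'cV[R]_n => A i ord0)) => //.
exact: coord_continuous.
Qed.

Lemma is_derive_coord (R : realType) (V : normedModType R) n
    (f : V -> 'cV[R]_n) x v d i :
  is_derive x v f d -> is_derive x v (fun y => f y i ord0) (d i ord0).
Proof.
move=> [fd dE].
have Q : (fun h : R => h^-1 *: ((f \o shift x) (h *: v) i ord0 - f x i ord0))
    @ (0 : R)^' --> d i ord0.
  have H : (fun h : R => (h^-1 *: ((f \o shift x) (h *: v) - f x)) i ord0)
      @ (0 : R)^' --> d i ord0.
    rewrite -dE.
    exact: (continuous_cvg _ (@coord_continuous _ _ _ i ord0 _) fd).
  rewrite (_ : (fun h => _) =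
    fun h : R => (h^-1 *: ((f \o shift x) (h *: v) - f x)) i ord0) //.
  by apply/funext => h; rewrite !mxE.
split; first by apply/cvg_ex; exists (d i ord0).
by rewrite /derive; apply: (cvg_lim (@Rhausdorff R) Q).
Qed.

(** The coefficients are scalar functions of time rather than one matrix-valued function, so that
    scalar calculus applies entry by entry. They are not assumed symmetric, whence the pairs
    [bform Q t x v + bform Q t v x] in the derivatives. *)
Definition bform (R : realType) n (Q : 'I_n -> 'I_n -> R -> R) (t : R)
    (x y : 'cV[R]_n) : R :=
  \sum_i \sum_j Q i j t * (x i ord0 * y j ord0).

Section BilinearForms.
Context {R : realType} {n : nat}.
Implicit Types (Q : 'I_n -> 'I_n -> R -> R) (x y z v : 'cV[R]_n) (t : R).

(** Expansion of [v] in the canonical basis. With its mirror image, it turns the row of partial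
    derivatives applied to [v] into a directional derivative. *)
Lemma bform_sumr Q t x v :
  bform Q t x v = \sum_k bform Q t x (delta_mx k ord0) * v k ord0.
Proof.
rewrite /bform; under [RHS]eq_bigr do rewrite mulr_suml.
rewrite [RHS]exchange_big/=; apply: eq_bigr => i _.
under [RHS]eq_bigr do rewrite mulr_suml.
rewrite [RHS]exchange_big/=; apply: eq_bigr => j _.
rewrite (bigD1 j)//= !mxE !eqxx/= big1 ?addr0; first by ring.
by move=> k kj; rewrite !mxE eq_sym (negbTE kj)/=; ring.
Qed.

Lemma bform_suml Q t x v :
  bform Q t v x = \sum_k bform Q t (delta_mx k ord0) x * v k ord0.
Proof.
rewrite /bform; under [RHS]eq_bigr do rewrite mulr_suml.
rewrite [RHS]exchange_big/=; apply: eq_bigr => i _.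
under [RHS]eq_bigr do rewrite mulr_suml.
rewrite [RHS]exchange_big/=; apply: eq_bigr => j _.
rewrite (bigD1 i)//= !mxE !eqxx/= big1 ?addr0; first by ring.
by move=> k kj; rewrite !mxE eq_sym (negbTE kj)/=; ring.
Qed.

Lemma is_derive_bform_time Q dQ t x y :
  (forall i j, is_derive t 1 (Q i j) (dQ i j t)) ->
  is_derive t 1 (fun s => bform Q s x y) (bform dQ t x y).
Proof.
move=> Qd; apply: is_derive_funsum => i; apply: is_derive_funsum => j.
apply: is_derive_eq (is_derive_funM (Qd i j)
  (is_derive_cst (x i ord0 * y j ord0) t 1)) _.
by rewrite mulr0 addr0.
Qed.

Lemma is_derive_bform_state Q t x v :
  is_derive x v (fun y => bform Q t y y) (bform Q t x v + bform Q t v x).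
Proof.
have cd i : is_derive x v (fun y => y i ord0) (v i ord0).
  exact: (is_derive_coord i (is_derive_id x v)).
rewrite /bform -big_split/=; apply: is_derive_funsum => i.
rewrite -big_split/=; apply: is_derive_funsum => j.
apply: is_derive_eq (is_derive_funMl _ (is_derive_funM (cd i) (cd j))) _.
by ring.
Qed.

Lemma is_derive_bform_along Q dQ (phi : R -> 'cV[R]_n) t d :
  (forall i j, is_derive t 1 (Q i j) (dQ i j t)) ->
  is_derive t 1 phi d ->
  is_derive t 1 (fun s => bform Q s (phi s) (phi s))
    (bform dQ t (phi t) (phi t) + (bform Q t (phi t) d + bform Q t d (phi t))).
Proof.
move=> Qd phid.
rewrite /bform -2!big_split/=; apply: is_derive_funsum => i.
rewrite -2!big_split/=; apply: is_derive_funsum => j.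
apply: is_derive_eq (is_derive_funM (Qd i j)
  (is_derive_funM (is_derive_coord i phid) (is_derive_coord j phid))) _.
by ring.
Qed.

Lemma cvg_bform Q (T : Type) (F : set_system T) {FF : Filter F} (s : T -> R)
    (f g : T -> 'cV[R]_n) t x y :
  (forall i j, Q i j (s p) @[p --> F] --> Q i j t) ->
  f @ F --> x -> g @ F --> y ->
  bform Q (s p) (f p) (g p) @[p --> F] --> bform Q t x y.
Proof.
move=> Qt fx gy.
apply: cvg_funsum => i; apply: cvg_funsum => j.
by apply: cvgM => //; apply: cvgM; exact: cvg_coord.
Qed.

Lemma continuous_bform Q (T : topologicalType) (s : T -> R)
    (f g : T -> 'cV[R]_n) :
  (forall i j, continuous (Q i j)) -> continuous s -> continuous f ->
  continuous g -> continuous (fun p => bform Q (s p) (f p) (g p)).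
Proof.
move=> Qc sc fc gc p; apply: cvg_bform; [|exact: fc|exact: gc] => i j.
exact: (continuous_comp (sc p) (Qc i j _)).
Qed.

End BilinearForms.

Section QuadraticLyapunov.
Context {R : realType} {n : nat}.
Variables (Q dQ : 'I_n -> 'I_n -> R -> R).
Hypothesis Qd : forall i j (t : R), is_derive t 1 (Q i j) (dQ i j t).
Let W (x : 'cV[R]_n) t := bform Q t x x.

Lemma gradt_bform x t : 0 <= t -> gradt W x t = bform dQ t x x.
Proof.
move=> t0; apply: lim_quotients_within; first exact: near_right_itvcy.
by apply: is_derive_bform_time => i j; exact: Qd.
Qed.

Lemma gradx_bform x t : gradx W x t =
  \row_i (bform Q t x (delta_mx i ord0) + bform Q t (delta_mx i ord0) x).
Proof.
apply/rowP => i; rewrite !mxE.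
exact: (@derive_val _ _ _ _ _ _ _ (is_derive_bform_state Q t x _)).
Qed.

Lemma gradx_bform_mul x t v :
  (gradx W x t *m v) ord0 ord0 = bform Q t x v + bform Q t v x.
Proof.
rewrite gradx_bform mxE bform_sumr (bform_suml _ _ x v) -big_split/=.
by apply: eq_bigr => k _; rewrite !mxE mulrDl.
Qed.

Lemma has_partials_bform : has_partials W.
Proof.
move=> x t t0; split.
  apply/cvg_ex; exists (bform dQ t x x : R).
  apply: is_derive_quotients_within.
  by apply: is_derive_bform_time => i j; exact: Qd.
move=> i; exact: (@ex_derive _ _ _ _ _ _ _ (is_derive_bform_state Q t x _)).
Qed.

Lemma C1_bform : (forall i j, continuous (dQ i j)) -> C1 W.
Proof.
move=> dQc; have Qc i j : continuous (Q i j) := is_derive_continuous (Qd i j).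
have fstc : continuous (fst : 'cV[R]_n * R -> 'cV[R]_n).
  by move=> ?; exact: cvg_fst.
have sndc : continuous (snd : 'cV[R]_n * R -> R) by move=> ?; exact: cvg_snd.
split; first exact: has_partials_bform.
(* The time gradient is identified with [bform dQ] for nonnegative times only, so continuity is
   transferred on that subspace. *)
- have c : {within [set p : 'cV[R]_n * R | 0 <= p.2],
      continuous (fun p => bform dQ p.2 p.1 p.1)}.
    by apply: continuous_subspaceT; exact: continuous_bform.
  apply: subspace_eq_continuous c => p; rewrite inE/= => p0.
  exact/esym/gradt_bform.
- apply: continuous_subspaceT.
  rewrite (_ : (fun p => _) = fun p : 'cV[R]_n * R => \row_i
    (bform Q p.2 p.1 (delta_mx i ord0) + bform Q p.2 (delta_mx i ord0) p.1)).
    move=> p; apply: (@cvg_mx R _ (nbhs p)) => i j.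
    rewrite mxE; under eq_cvg do rewrite mxE.
    have cdelta : continuous (fun _ : 'cV[R]_n * R => delta_mx j ord0 : 'cV[R]_n).
      by move=> ?; exact: cvg_cst.
    by apply: cvgD; exact: continuous_bform.
  by apply/funext => p; rewrite gradx_bform.
Qed.

End QuadraticLyapunov.

(** * Existence for linear differential equations *)

Section LocallyUniformLimit.
Context {R : realType}.
Variables (S : nat -> R -> R) (E : R -> R).
Hypothesis Sc : forall N, continuous (S N).
Hypothesis Ec : continuous E.
Hypothesis SE : forall N t, `|S N.+1 t - S N t| <= E t * 2^-1 ^+ N.

Let E_ge0 t : 0 <= E t.
Proof. by have := SE 0 t; rewrite expr0 mulr1; apply: le_trans. Qed.

(** Telescoping. Keeping the difference of the two powers, and not just the first one, makes the
    induction close with equality. *)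
Let S_dist N d t :
  `|S (N + d)%N t - S N t| <= 2 * E t * (2^-1 ^+ N - 2^-1 ^+ (N + d)).
Proof.
elim: d => [|d IH]; first by rewrite addn0 !subrr normr0 mulr0.
rewrite addnS (le_trans (ler_distD (S (N + d)%N t) _ _))//.
rewrite (le_trans (lerD (SE _ _) IH))//.
by rewrite [_ ^+ (N + d).+1]exprS le_eqVlt; apply/orP; left; apply/eqP; field.
Qed.

(** At each point the increments are dominated by a geometric series. As [E] is continuous, it is at
    most [E t + 1] near [t], so convergence is locally uniform and continuity passes to the limit by
    a three-term estimate. *)
Lemma geometric_locally_uniform_limit : exists2 phi : R -> R,
  continuous phi & forall N t, `|phi t - S N t| <= 2 * E t * 2^-1 ^+ N.
Proof.
have cvS t : cvgn (S ^~ t).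
  have : cvgn (series (telescope (S ^~ t))).
    apply: normed_cvg; apply: (@series_le_cvg _ _ (geometric (E t) 2^-1)).
    - by move=> N; exact: normr_ge0.
    - by move=> N; rewrite /= mulr_ge0// exprn_ge0// invr_ge0.
    - by move=> N; exact: SE.
    - apply: is_cvg_geometric_series.
      by rewrite ger0_norm ?invr_ge0// invf_lt1// ltr1n.
  rewrite telescopeK => /cvg_ex[l sl]; apply/cvg_ex; exists (l + S 0 t).
  rewrite (_ : S ^~ t = (fun N => S N t - S 0 t) \+ cst (S 0 t)); last first.
    by apply/funext => N; rewrite /= subrK.
  by apply: cvgD => //; exact: cvg_cst.
pose phi t := limn (S ^~ t).
have phiS N t : `|phi t - S N t| <= 2 * E t * 2^-1 ^+ N.
  have c : (fun M => `|S M t - S N t|) @ \oo --> `|phi t - S N t|.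
    by apply: cvg_norm; apply: cvgB; [exact: cvS|exact: cvg_cst].
  rewrite -(cvg_lim (@Rhausdorff R) c); apply: limr_le.
    by apply/cvg_ex; eexists; exact: c.
  exists N => // M /= NM; rewrite -(subnKC NM) (le_trans (S_dist _ _ _))//.
  apply: ler_wpM2l; first exact: mulr_ge0.
    by rewrite gerBl exprn_ge0// invr_ge0.
exists phi => // t; apply/cvgrPdist_le => e e0.
have [N Ne] : exists N, 2 * (E t + 1) * 2^-1 ^+ N <= e / 3.
  have g : geometric (2 * (E t + 1)) (2^-1 : R) @ \oo --> (0 : R).
    by apply: cvg_geometric; rewrite ger0_norm ?invr_ge0// invf_lt1// ltr1n.
  have /cvgrPdist_le/(_ (e / 3)) := g.
  rewrite divr_gt0// => /(_ isT)[N _ /(_ N (leqnn N))]; rewrite /= sub0r normrN.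
  by move=> H; exists N; apply: le_trans H; exact: ler_norm.
have near_E : \forall s \near t, E s <= E t + 1.
  have /cvgrPdist_le/(_ 1 ltr01) : E @ t --> E t by exact: Ec.
  by apply: filterS => s; rewrite ler_distlC => /andP[_]; rewrite addrC.
have /cvgrPdist_le/(_ (e / 3)) : S N @ t --> S N t by exact: Sc.
rewrite divr_gt0// => /(_ isT) near_S.
near=> s.
have H1 u : E u <= E t + 1 -> `|phi u - S N u| <= e / 3.
  move=> Eu; rewrite (le_trans (phiS N u))// (le_trans _ Ne)//.
  by rewrite ler_wpM2r ?exprn_ge0 ?invr_ge0// ler_wpM2l.
have H2 : `|phi t - S N t| <= e / 3 by apply: H1; rewrite lerDl.
have H3 : `|phi s - S N s| <= e / 3 by apply: H1; near: s.
have H4 : `|S N t - S N s| <= e / 3 by near: s.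
rewrite (_ : phi t - phi s =
  (phi t - S N t) + (S N t - S N s) - (phi s - S N s)); last by ring.
rewrite (le_trans (ler_normB _ _))// (le_trans (lerD (ler_normD _ _) H3))//.
rewrite (le_trans (lerD (lerD H2 H4) (lexx _)))//.
by rewrite le_eqVlt; apply/orP; left; apply/eqP; field.
Unshelve. all: by end_near. Qed.

End LocallyUniformLimit.

Section LinearODE.
Context {R : realType}.
Notation mu := (@lebesgue_measure R).

(** The [Num.max] accounts for the value 0 of the integral when [t < a], and gives continuity on the
    whole line at once. *)
Lemma Rintegral_itvE (g G : R -> R) a t : primitive_of g G ->
  \int[mu]_(r in `[a, t]) g r = G (Num.max a t) - G a.
Proof.
move=> [_ Gint]; have [ta|/ltW at_] := leP t a.
  by rewrite Rintegral_itv_rev// subrr.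
by rewrite Gint.
Qed.

Lemma Rintegral_itv_continuous (g : R -> R) a : continuous g ->
  continuous (fun t => \int[mu]_(r in `[a, t]) g r).
Proof.
move=> /primitive_exists[G Gg].
have Gc : continuous G := is_derive_continuous Gg.1.
rewrite (_ : (fun t => _) = fun t => G (Num.max a t) - G a); last first.
  by apply/funext => t; exact: Rintegral_itvE.
move=> t; apply: cvgB; last exact: cvg_cst.
apply: (continuous_comp (f := fun t => Num.max a t) (g := G)).
  by apply: (@continuous_max _ _ (cst a) id) => //; exact: cst_continuous.
exact: Gc.
Qed.

Lemma is_derive_expRM (k a t : R) :
  is_derive t 1 (fun s => expR (k * (s - a))) (k * expR (k * (t - a))).
Proof.
have d : is_derive t 1 (fun s => k * (s - a)) k.
  apply: is_derive_eq (is_derive_funMl k (is_deriveB (is_derive_id t 1)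
    (is_derive_cst a t 1))) _.
  by rewrite subr0 mulr1.
by apply: is_derive_eq (is_derive1_comp (is_derive_expR _) d) _; rewrite mulrC.
Qed.

(** Integrating [k * expR (k * (s - a))] gives back the exponential without the factor [k]: in an
    exponentially weighted norm, integration gains a factor [k^-1]. *)
Lemma le_dist_Rintegral_expR (f g : R -> R) (C k a t : R) :
  continuous f -> continuous g -> 0 <= C ->
  (forall s, a <= s -> s <= t ->
    `|f s - g s| <= C * (k * expR (k * (s - a)))) ->
  `|\int[mu]_(r in `[a, t]) f r - \int[mu]_(r in `[a, t]) g r|
    <= C * expR (k * `|t - a|).
Proof.
move=> fc gc C0 fg; have [ta|/ltW at_] := leP t a.
  by rewrite !Rintegral_itv_rev// subrr normr0 mulr_ge0// expR_ge0.
have [F [Fd Fi]] := primitive_exists fc; have [G [Gd Gi]] := primitive_exists gc.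
rewrite Fi// Gi// [`|t - a|]ger0_norm ?subr_ge0//.
rewrite (_ : F t - F a - (G t - G a) = (F t - G t) - (F a - G a)); last by ring.
have Dd (s : R) : is_derive s 1 (fun s => F s - G s) (f s - g s).
  exact: is_deriveB.
have Dd' (s : R) : is_derive s 1 (fun s => - (F s - G s)) (- (f s - g s)).
  exact: is_deriveN.
have Ed (s : R) : is_derive s 1 (fun s => C * expR (k * (s - a)))
    (C * (k * expR (k * (s - a)))).
  by apply: is_derive_funMl; exact: is_derive_expRM.
have fg1 s : a <= s -> s <= t -> f s - g s <= C * (k * expR (k * (s - a))).
  by move=> as_ st; rewrite (le_trans (ler_norm _))// fg.
have fg2 s : a <= s -> s <= t -> - (f s - g s) <= C * (k * expR (k * (s - a))).
  by move=> as_ st; rewrite (le_trans (ler_norm _))// normrN fg.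
have H1 := le_of_derive_le Dd Ed at_ fg1.
have H2 := le_of_derive_le Dd' Ed at_ fg2.
move: H1 H2; rewrite subrr mulr0 expR0 mulr1 => H1 H2.
by rewrite ler_norml; apply/andP; split; lra.
Qed.

Context {n : nat}.
Variables (A : 'I_n -> 'I_n -> R -> R) (L to : R) (xo : 'cV[R]_n).
Hypothesis Ac : forall i j, continuous (A i j).
Hypothesis L_ge0 : 0 <= L.
Hypothesis AL : forall i t, \sum_j `|A i j t| <= L.

Let rhs (u : 'I_n -> R -> R) i t := \sum_j A i j t * u j t.

Let rhs_continuous u : (forall i, continuous (u i)) ->
  forall i, continuous (rhs u i).
Proof.
by move=> uc i t; apply: cvg_funsum => j; apply: cvgM; [exact: Ac|exact: uc].
Qed.

Let rhs_dist u v (t c : R) : (forall i, `|u i t - v i t| <= c) ->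
  forall i, `|rhs u i t - rhs v i t| <= L * c.
Proof.
move=> uv i; rewrite /rhs -sumrB (le_trans (ler_norm_sum _ _ _))//.
have c0 : 0 <= c by rewrite (le_trans _ (uv i)).
apply: (@le_trans _ _ (\sum_j `|A i j t| * c)).
  by apply: ler_sum => j _; rewrite -mulrBr normrM ler_wpM2l.
by rewrite -mulr_suml ler_wpM2r.
Qed.

(** Before [to] the integral vanishes, so every iterate after the first keeps the value [xo]
    there. *)
Fixpoint picard N : 'I_n -> R -> R :=
  if N is N'.+1 then
    fun i t => xo i ord0 + \int[mu]_(s in `[to, t]) rhs (picard N') i s
  else fun _ _ => 0.

Let picard_continuous N i : continuous (picard N i).
Proof.
elim: N i => [|N IH] i t; first exact: cvg_cst.
apply: cvgD; first exact: cvg_cst.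
have Zc := Rintegral_itv_continuous (rhs_continuous IH (i := i)).
exact: Zc.
Qed.

Let X := \sum_i `|xo i ord0|.
(** Exponential weight for the Picard estimates. The rate is twice the Lipschitz constant [L], so
    each iteration halves the weighted error, over arbitrarily long times. *)
Let E t := X * expR (2 * L * `|t - to|).

Let X_ge0 : 0 <= X. Proof. exact: sumr_ge0. Qed.

Let E_continuous : continuous E.
Proof.
move=> t; apply: cvgM; first exact: cvg_cst.
apply: (continuous_comp (f := fun s => 2 * L * `|s - to|) (g := expR)).
  apply: cvgM; first exact: cvg_cst.
  by apply: cvg_norm; apply: cvgB; [exact: cvg_id|exact: cvg_cst].
exact: continuous_expR.
Qed.

Let picard_step N t i : `|picard N.+1 i t - picard N i t| <= E t * 2^-1 ^+ N.
Proof.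
elim: N t i => [|N IH] t i.
  rewrite /= subr0 expr0 mulr1 (_ : Rintegral _ _ _ =
      \int[mu]_(s in `[to, t]) cst 0 s); last first.
    apply: eq_Rintegral.
    by move=> s _; rewrite /rhs big1// => j _; rewrite mulr0.
  rewrite Rintegral_cst// mul0r addr0 /E.
  apply: (@le_trans _ _ X).
    by rewrite /X (bigD1 i)//= lerDl sumr_ge0.
  rewrite ler_peMr// -expR0 ler_expR !mulr_ge0//.
rewrite [picard N.+2]/= [X in _ - X]/=.
rewrite addrAC opprD addrA subrr sub0r addrC.
rewrite (_ : E t * _ = X * 2^-1 ^+ N.+1 * expR (2 * L * `|t - to|)); last first.
  by rewrite /E; ring.
apply: le_dist_Rintegral_expR.
- by apply: rhs_continuous => j; exact (@picard_continuous N.+1 j).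
- by apply: rhs_continuous => j; exact (@picard_continuous N j).
- by rewrite mulr_ge0// exprn_ge0// invr_ge0.
- move=> s tos st; apply: le_trans (rhs_dist (IH s) i) _.
  rewrite /E ger0_norm ?subr_ge0// exprS le_eqVlt; apply/orP; left.
  by apply/eqP; field.
Qed.

Lemma linear_ode_exists : exists psi : R -> 'cV[R]_n, psi to = xo /\
  forall t, to <= t -> forall i, is_derive t 1 (fun s => psi s i ord0)
    (\sum_j A i j t * psi t j ord0).
Proof.
have H i : exists phi : R -> R, continuous phi /\
    forall N t, `|phi t - picard N i t| <= 2 * E t * 2^-1 ^+ N.
  have [phi phic phiE] := @geometric_locally_uniform_limit R
    (fun N => picard N i) E (fun N => @picard_continuous N i) E_continuous
    (fun N t => picard_step N t i).
  by exists phi.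
have [phi phiP] := choice H.
have phic i : continuous (phi i) by have [] := phiP i.
have rc := rhs_continuous phic.
(* Passing to the limit in the recursion: [phi] is within [E t * 2^-1 ^+ N] of iterate [N.+1], and
   the two integrals differ by at most the same amount. *)
have fix_ i t : phi i t = xo i ord0 + \int[mu]_(s in `[to, t]) rhs phi i s.
  apply/eqP; rewrite -subr_eq0 -normr_le0; apply/ler_addgt0Pl => e e0.
  rewrite addr0.
  have g : geometric (4 * E t) (2^-1 : R) @ \oo --> (0 : R).
    by apply: cvg_geometric; rewrite ger0_norm ?invr_ge0// invf_lt1// ltr1n.
  have /cvgrPdist_le/(_ e e0)[N _ /(_ N (leqnn N))] := g.
  rewrite /= sub0r normrN => /(le_trans (ler_norm _)); apply: le_trans.
  have := (phiP i).2 N.+1 t; rewrite [picard _]/= => H1.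
  have H2 : `|\int[mu]_(s in `[to, t]) rhs (picard N) i s -
      \int[mu]_(s in `[to, t]) rhs phi i s| <=
      X * 2^-1 ^+ N * expR (2 * L * `|t - to|).
    apply: le_dist_Rintegral_expR.
    - by apply: rhs_continuous => j; exact (@picard_continuous N j).
    - exact: rc.
    - by rewrite mulr_ge0// exprn_ge0// invr_ge0.
    - move=> s tos st.
      have D j : `|picard N j s - phi j s| <= 2 * E s * 2^-1 ^+ N.
        by rewrite distrC; exact: (phiP j).2.
      apply: le_trans (rhs_dist D i) _.
      rewrite /E ger0_norm ?subr_ge0// le_eqVlt; apply/orP; left.
      by apply/eqP; ring.
  rewrite (_ : phi i t - _ = (phi i t - (xo i ord0 +
      \int[mu]_(s in `[to, t]) rhs (picard N) i s)) +
      (\int[mu]_(s in `[to, t]) rhs (picard N) i s -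
      \int[mu]_(s in `[to, t]) rhs phi i s)); last by ring.
  rewrite (le_trans (ler_normD _ _))// (le_trans (lerD H1 H2))//.
  have E0 : 0 <= E t * 2^-1 ^+ N.
    by rewrite mulr_ge0 ?mulr_ge0 ?exprn_ge0 ?invr_ge0 ?expR_ge0.
  have -> : X * 2^-1 ^+ N * expR (2 * L * `|t - to|) = E t * 2^-1 ^+ N.
    by rewrite /E; ring.
  have -> : 2 * E t * 2^-1 ^+ N.+1 = E t * 2^-1 ^+ N by rewrite exprS; field.
  lra.
have [G GP] := choice (fun i => primitive_exists (rc i)).
(* [phi] is constant before [to], so it may have a corner there. Replacing the integral by
   increments of a primitive keeps the values from [to] on and makes the derivative two-sided at
   [to]. *)
pose psi t : 'cV[R]_n := \col_i (xo i ord0 + (G i t - G i to)).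
have psiE t i : to <= t -> psi t i ord0 = phi i t.
  by move=> tot; rewrite mxE fix_ (GP i).2.
exists psi; split.
  by apply/colP => i; rewrite mxE subrr addr0.
move=> t tot i; rewrite (_ : (fun s => _) =
  fun s => xo i ord0 + (G i s - G i to)); last by apply/funext => s; rewrite mxE.
have d : is_derive t 1 (fun s => xo i ord0 + (G i s - G i to))
    (0 + (rhs phi i t - 0)).
  apply: is_deriveD; apply: is_deriveB; exact: (GP i).1.
apply: is_derive_eq d _; rewrite add0r subr0.
by apply: eq_bigr => j _; rewrite psiE.
Qed.

End LinearODE.

(** * Exponential decay along trajectories *)

Section WithinDerivatives.
Context {R : realType} {U : normedModType R}.
Implicit Types (A : set R) (f : R -> U) (s : R) (d : U).

Lemma quotients_within_is_derive A f s d :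
  (\forall r \near s, A r) -> quotients_within A f s --> d ->
  is_derive s 1 f d.
Proof.
move=> /nbhs0P nA fd.
have Q : (fun h : R => h^-1 *: ((f \o shift s) (h *: 1) - f s))
    @ (0 : R)^' --> d.
  rewrite (_ : (fun h => _) = fun h : R => h^-1 *: (f (s + h) - f s)); last first.
    by apply/funext => h /=; rewrite [h%:A]mulr1 (addrC s h).
  apply: cvg_trans fd; apply: cvg_app => P.
  move=> H.
  have H' : \forall h \near (0 : R), h != 0 -> A (s + h) -> P h.
    exact: H.
  by apply: filterS2 nA H' => h Ah + h0; apply.
split; first by apply/cvg_ex; exists d.
by rewrite /derive; apply: (cvg_lim (@norm_hausdorff _ U) Q).
Qed.

(** Near [s] the quotients are bounded by [|d| + 1], so increments are at most linear. This supplies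
    continuity at the endpoints of a trajectory, where only one-sided quotients converge. *)
Lemma quotients_within_cvg A f s d :
  quotients_within A f s --> d -> f @ within A (nbhs s) --> f s.
Proof.
move=> fd.
have nq : \forall u \near (0 : R), u != 0 -> A (s + u) ->
    `|f (s + u) - f s| <= `|u| * (`|d| + 1).
  have H : \forall u \near (0 : R), u != 0 -> A (s + u) ->
      ball d 1 (u^-1 *: (f (s + u) - f s)).
    exact: (fd _ (nbhsx_ballx d _ ltr01)).
  apply: filterS H => u H u0 Au; have := H u0 Au.
  rewrite -ball_normE/= => qu.
  rewrite (_ : f (s + u) - f s = u *: (u^-1 *: (f (s + u) - f s))); last first.
    by rewrite scalerA divff// scale1r.
  rewrite normrZ ler_wpM2l// -lerBlDl (le_trans _ (ltW qu))//.
  by rewrite distrC lerB_dist.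
apply/cvgrPdist_lt => e e0.
suff : \forall y \near s, A y -> `|f s - f y| < e by [].
apply/nbhs0P.
have ne : \forall u \near (0 : R), `|u| < e / (`|d| + 1).
  have p : 0 < e / (`|d| + 1) by rewrite divr_gt0// ltr_wpDl.
  by exists (e / (`|d| + 1)) => // u; rewrite /ball_/= sub0r normrN.
apply: filterS2 nq ne => u Hq ue Au.
have [->|u0] := eqVneq u 0; first by rewrite addr0 subrr normr0.
rewrite distrC (le_lt_trans (Hq u0 Au))// -ltr_pdivlMr// ltr_wpDl//.
Qed.

End WithinDerivatives.

(** * Euclidean norm and comparison functions *)

Section EuclideanNorm.
Context {R : realType} {n : nat}.
Implicit Types x : 'cV[R]_n.

Lemma enorm_ge0 x : 0 <= enorm x.
Proof. exact: sqrtr_ge0. Qed.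

Lemma enorm_sqr x : enorm x ^+ 2 = \sum_i x i ord0 ^+ 2.
Proof. by rewrite sqr_sqrtr// sumr_ge0// => i _; exact: sqr_ge0. Qed.

End EuclideanNorm.

Lemma class_Kinfty_sqr (R : realType) (b : R) : 0 < b ->
  class_Kinfty (fun s : R => b * s ^+ 2).
Proof.
move=> b0; split.
- apply: continuous_subspaceT => s; apply: cvgM; first exact: cvg_cst.
  by rewrite expr2; under eq_cvg do rewrite expr2; apply: cvgM; exact: cvg_id.
- move=> s t s0 st.
  by rewrite ltr_pM2l// ltr_pXn2r// ?nnegrE// ltW// (le_lt_trans s0).
(* With [q] for the quotient, the added 1 ensures that [(q + 1) ^+ 2] is at least [q], whether or
   not [q] exceeds 1. *)
- move=> B; exists ((`|B| + 1) / b + 1).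
    by rewrite addr_ge0// divr_ge0 ?addr_ge0// ltW.
  have q0 : 0 <= (`|B| + 1) / b by rewrite divr_ge0 ?addr_ge0// ltW.
  apply: (@lt_le_trans _ _ (b * ((`|B| + 1) / b))).
    by rewrite mulrC divfK ?gt_eqF// (le_lt_trans (ler_norm B))// ltrDl.
  by rewrite ler_pM2l//; nra.
- by rewrite expr0n mulr0.
Qed.

Lemma class_KL_exponential (R : realType) (C k : R) : 0 < C -> 0 < k ->
  class_KL (fun s t : R => C * expR (- (k * t)) * s).
Proof.
move=> C0 k0.
have e0 t : 0 < C * expR (- (k * t)) by rewrite mulr_gt0// expR_gt0.
split.
- apply: continuous_subspaceT => p; apply: cvgM; last exact: cvg_fst.
  apply: cvgM; first exact: cvg_cst.
  apply: (continuous_comp (f := fun p : R * R => - (k * p.2)) (g := expR)).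
    by apply: cvgN; apply: cvgM; [exact: cvg_cst|exact: cvg_snd].
  exact: continuous_expR.
- move=> t t0; split.
  + apply: continuous_subspaceT => s; apply: cvgM; [exact: cvg_cst|exact: cvg_id].
  + by move=> s u s0 su; rewrite ltr_pM2l.
  + move=> M; exists ((`|M| + 1) / (C * expR (- (k * t)))).
      by rewrite divr_ge0 ?(ltW (e0 t))// addr_ge0.
    by rewrite mulrC divfK ?gt_eqF// (le_lt_trans (ler_norm M))// ltrDl.
  + by rewrite mulr0.
- move=> s t1 t2 s0 t10 t12; rewrite ler_wpM2r// ler_wpM2l ?(ltW C0)//.
  by rewrite ler_expR lerN2 ler_wpM2l// ltW.
- move=> s s0; rewrite -(mul0r s); apply: cvgM; last exact: cvg_cst.
  rewrite -(mulr0 C); apply: cvgM; first exact: cvg_cst.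
  apply: (cvg_comp (fun t => k * t) (fun u => expR (- u)) (G := pinfty_nbhs R)).
    apply/cvgryPge => A; exists (A / k); split; first exact: num_real.
    by move=> t; rewrite ltr_pdivrMr// mulrC => /ltW.
  exact: cvgr_expR.
Qed.

Section QuadraticDecay.
Context {R : realType} {n : nat}.
Variables (Q dQ : 'I_n -> 'I_n -> R -> R) (F : 'cV[R]_n -> R -> 'cV[R]_n).
Variable k : R.
Hypothesis Qd : forall i j (t : R), is_derive t 1 (Q i j) (dQ i j t).
Hypothesis decay : forall x t, 0 <= t ->
  bform dQ t x x + (bform Q t x (F x t) + bform Q t (F x t) x)
    <= - (k * bform Q t x x).

(** Integrating factor: [expR (k * (s - to))] times the form along [phi] has nonpositive derivative
    inside the interval and is continuous up to its endpoints, hence does not increase. A trajectory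
    on [[to, t]] alone suffices, as the definition of [UGAS] demands. *)
Lemma bform_decay xo to t phi : 0 <= to -> to <= t ->
  trajectory F `[to, t] to xo phi ->
  bform Q t (phi t) (phi t) <= expR (- (k * (t - to))) * bform Q to xo xo.
Proof.
move=> to0 tot [phio phid].
pose v s := bform Q s (phi s) (phi s).
pose w s := expR (k * (s - to)) * v s.
have wd s : s \in `]to, t[ -> is_derive s 1 w
   (k * expR (k * (s - to)) * v s +
    expR (k * (s - to)) * (bform dQ s (phi s) (phi s) + (bform Q s (phi s) (F (phi s) s) + bform Q s (F (phi s) s) (phi s)))).
  move=> st; apply: is_derive_funM; first exact: is_derive_expRM.
  apply: (is_derive_bform_along (fun i j => Qd i j s)).
  have nA : \forall r \near s, [set` `[to, t]] r.
    apply: filterS (near_in_itvoo st) => r.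
    by rewrite /= !in_itv/= => /andP[/ltW-> /ltW->].
  apply: (quotients_within_is_derive nA (phid s _)).
  exact: nbhs_singleton nA.
have wc : {within `[to, t], continuous w}.
  apply/subspace_continuousP => s st; apply: cvgM.
    apply: cvg_within_filter.
    exact: (is_derive_continuous (fun r : R => is_derive_expRM k to r)).
  apply: cvg_bform; last 2 first.
  - exact: quotients_within_cvg (phid s st).
  - exact: quotients_within_cvg (phid s st).
  move=> i j; apply: cvg_within_filter.
  exact: (is_derive_continuous (Qd i j)).
have : w t <= w to.
  apply: (@ler0_derive1_le_cc _ w to t) => //; rewrite ?in_itv/= ?lexx ?tot//.
  - by move=> s st; have [] := wd s st.
  - move=> s st; rewrite derive1E (@derive_val _ _ _ _ _ _ _ (wd s st)).
    rewrite [k * _]mulrC -mulrA -mulrDr mulr_ge0_le0 ?expR_ge0//.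
    rewrite -lerBrDl sub0r; apply: decay.
    by move: st; rewrite in_itv/= => /andP[/ltW/(le_trans to0)].
rewrite /w subrr mulr0 expR0 mul1r /v phio => H.
by rewrite expRN ler_pdivlMl ?expR_gt0.
Qed.

(** The form is comparable to the squared norm, so its decay is read after taking square roots: this
    turns [b / a] into its root and the rate [k] into [k / 2]. *)
Lemma quadratic_UGAS (a b : R) : 0 < k -> 0 < a -> a <= b ->
  (forall x t, 0 <= t ->
    a * enorm x ^+ 2 <= bform Q t x x <= b * enorm x ^+ 2) ->
  (forall xo to, 0 <= to -> exists phi, trajectory F `[to, +oo[ to xo phi) ->
  UGAS F.
Proof.
move=> k0 a0 ab Qab Fex.
have ba : 1 <= b / a by rewrite ler_pdivlMr// mul1r.
exists (fun s t => Num.sqrt (b / a) * expR (- (k / 2 * t)) * s).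
  by apply: class_KL_exponential; rewrite ?divr_gt0// sqrtr_gt0 (lt_le_trans ltr01).
move=> xo to to0; split; first exact: Fex.
move=> t phi tot tr; have t0 := le_trans to0 tot.
rewrite -(@ler_pXn2r _ 2) ?nnegrE ?enorm_ge0//; last first.
  by rewrite !mulr_ge0 ?sqrtr_ge0 ?expR_ge0 ?enorm_ge0.
rewrite !exprMn (@sqr_sqrtr _ (b / a)) ?(le_trans ler01)// -expRM_natr.
rewrite (_ : _ * 2 = - (k * (t - to))); last by field.
rewrite -(ler_pM2l a0).
have /andP[H1 _] := Qab (phi t) t t0.
have /andP[_ H2] := Qab xo to to0.
rewrite (le_trans H1)// (le_trans (bform_decay to0 tot tr))//.
rewrite (_ : a * _ = expR (- (k * (t - to))) * (b * enorm xo ^+ 2)); last first.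
  by field; rewrite gt_eqF.
by rewrite ler_wpM2l ?expR_ge0.
Qed.

End QuadraticDecay.

(** * The Lyapunov estimate *)

Section WindowIntegrals.
Context {R : realType}.
Notation mu := (@lebesgue_measure R).
Implicit Types (f F FF : R -> R) (a b c t : R).

(** Two primitives of the same function have equal increments, by [le_of_derive_le] in both
    directions. *)
Lemma Rintegral_FTC f F a b : continuous f ->
  (forall t : R, is_derive t 1 F (f t)) -> a <= b ->
  \int[mu]_(r in `[a, b]) f r = F b - F a.
Proof.
move=> fc Fd ab; have [G [Gd ->//]] := primitive_exists fc.
by apply/le_anti; rewrite !(le_of_derive_le _ _ ab (fun _ _ _ => lexx _)).
Qed.

Lemma is_derive_window F f c t : (forall s : R, is_derive s 1 F (f s)) ->
  is_derive t 1 (fun s => F (s - c)) (f (t - c)).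
Proof.
move=> Fd; have d : is_derive t 1 (fun s => s - c) (1 - 0).
  exact: is_deriveB.
by apply: is_derive_eq 
  (@is_derive1_comp _ F (fun s => s - c) t _ _ (Fd (t - c)) d) _;
  rewrite subr0 mulr1.
Qed.

(** The inner integral is [F t - F s], whose primitive in [s] is [F t * s - FF s]. The resulting
    closed form depends on [t] through [F] and [FF] only, so no integral has to be differentiated
    under the integral sign. *)
Lemma window_double_Rintegral f F FF c t : continuous f -> 0 <= c ->
  (forall s : R, is_derive s 1 F (f s)) ->
  (forall s : R, is_derive s 1 FF (F s)) ->
  \int[mu]_(s in `[t - c, t]) \int[mu]_(l in `[s, t]) f l =
  c * F t - (FF t - FF (t - c)).
Proof.
move=> fc c0 Fd FFd; have Fc := is_derive_continuous Fd.
transitivity (\int[mu]_(s in `[t - c, t]) (F t - F s)).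
  apply: eq_Rintegral => s; rewrite inE/= in_itv/= => /andP[_ st].
  by rewrite (Rintegral_FTC fc Fd st).
have d (s : R) : is_derive s 1 (fun s => F t * s - FF s) (F t - F s).
  have d1 : is_derive s 1 (fun s => F t * s) (F t).
    apply: is_derive_eq (is_derive_funMl (F t) (is_derive_id s 1)) _.
    by rewrite mulr1.
  exact: is_deriveB.
have fFc : continuous (fun s => F t - F s).
  by move=> s; apply: cvgB; [exact: cvg_cst|exact: Fc].
have tc : t - c <= t by rewrite gerBl.
by rewrite (Rintegral_FTC fFc d tc); ring.
Qed.

(** The left side is the integral of [F t - F s] over the window. The integrand is at most
    [B * (t - s)], whose integral is [B] times the area of a triangle of side [c]. *)
Lemma window_le f F FF B c t : 0 <= c ->
  (forall s : R, is_derive s 1 F (f s)) ->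
  (forall s : R, is_derive s 1 FF (F s)) ->
  (forall s, f s <= B) ->
  c * F t - (FF t - FF (t - c)) <= B * c ^+ 2 / 2.
Proof.
move=> c0 Fd FFd fB.
have idd (s : R) : is_derive s 1 (fun r => r) (1 : R) by exact: is_derive_id.
have FB s : s <= t -> F t - F s <= B * (t - s).
  move=> st; rewrite mulrBr.
  apply: (le_of_derive_le Fd (dg := fun=> B) _ st) => // r.
  by apply: is_derive_eq (is_derive_funMl B (idd r)) _; rewrite mulr1.
have d1 (s : R) : is_derive s 1 (fun s => F t * s - FF s) (F t - F s).
  have d : is_derive s 1 (fun s => F t * s) (F t).
    by apply: is_derive_eq (is_derive_funMl (F t) (idd s)) _; rewrite mulr1.
  exact: is_deriveB.
have d2 (s : R) : is_derive s 1 (fun s => B * t * s + (- (B / 2)) * (s * s))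
    (B * (t - s)).
  apply: is_derive_eq (is_derive_funD (is_derive_funMl (B * t) (idd s))
    (is_derive_funMl (- (B / 2)) (is_derive_funM (idd s) (idd s)))) _.
  by field.
have tc : t - c <= t by rewrite gerBl.
have := le_of_derive_le d1 d2 tc (fun s _ st => FB s st).
rewrite (_ : F t * t - _ - _ = c * F t - (FF t - FF (t - c))); last by ring.
by rewrite (_ : B * t * t + _ - _ = B * c ^+ 2 / 2); last by field.
Qed.

Lemma window_ge f F FF B c t : 0 <= c ->
  (forall s : R, is_derive s 1 F (f s)) ->
  (forall s : R, is_derive s 1 FF (F s)) ->
  (forall s, B <= f s) ->
  B * c ^+ 2 / 2 <= c * F t - (FF t - FF (t - c)).
Proof.
move=> c0 Fd FFd Bf.
have Fd' (s : R) : is_derive s 1 (fun r => - F r) (- f s) by exact: is_deriveN.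
have FFd' (s : R) : is_derive s 1 (fun r => - FF r) (- F s) by exact: is_deriveN.
have NfB s : - f s <= - B by rewrite lerN2.
have := window_le t c0 Fd' FFd' NfB.
by move=> H; lra.
Qed.

End WindowIntegrals.

(* [a] stands for [- h], [p] for the component of [x] along [m], [S] for the
   cross terms [x^T M m + m^T M x], where [M] is the double integral in [P]. *)
Lemma lyapunov_decay_inequality (R : realFieldType)
    (T c al au K kap k a p X Mx S A da w V : R) :
  0 < T -> 0 < c -> 0 < al -> 0 < au -> 0 <= X ->
  kap = c / 2 + (au ^+ 2 * c ^+ 4) / (2 * al) + c ^+ 2 ->
  K = kap + c ^+ 2 * au ->
  k = al ^+ 2 / (2 * K) / (2 * T) ->
  0 <= a -> a <= au -> 0 <= Mx -> Mx <= c ^+ 2 / 2 * X ->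
  S ^+ 2 <= c ^+ 4 * X -> al * X <= A -> `|da| <= k -> w <= - al ->
  V = kap * X + a * Mx ->
  (al / (2 * K) * a + al / (2 * T * K) * w) * V + da * Mx
    + a * (c * p ^+ 2 - A) - a * p * (2 * kap * p + a * S) <= - (k * V).
Proof.
move=> T0 c0 al0 au0 X0 kapE KE kE a0 aau Mx0 MxX SX alA dak wal VE.
have c20 : 0 < c ^+ 2 by rewrite exprn_gt0.
(* The summand [c ^+ 2] of [kap] makes [V] dominate [Mx], which the bound on the [da] term
   requires. *)
have kap_c : c ^+ 2 <= kap.
  rewrite kapE lerDr addr_ge0 ?divr_ge0 ?mulr_ge0 ?exprn_ge0 ?ltW//.
have kap0 : 0 < kap := lt_le_trans c20 kap_c.
have K0 : 0 < K by rewrite KE addr_gt0// mulr_gt0.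
have k0 : 0 < k by rewrite kE !divr_gt0 ?mulr_gt0// exprn_gt0.
have V0 : 0 <= V by rewrite VE addr_ge0 ?mulr_ge0// ltW.
have VK : V <= K * X.
  rewrite VE KE mulrDl lerD2l.
  apply: (@le_trans _ _ (au * (c ^+ 2 / 2 * X))); first exact: ler_pM.
  have : 0 <= au * c ^+ 2 * X by rewrite !mulr_ge0// ltW.
  lra.
have Vc : c ^+ 2 * X <= V.
  rewrite VE (le_trans (ler_wpM2r X0 kap_c))// lerDl mulr_ge0//.
(* The [a] part of the weight costs half of the decay [al * X]; the other half is left for the cross
   term in [H4]. *)
have H1 : al / (2 * K) * a * V <= a * (al / 2 * X).
  have -> : al / (2 * K) * a * V = a * (al / 2 * (V / K)) by field; rewrite gt_eqF.
  have al2 : 0 <= al / 2 by rewrite divr_ge0// ltW.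
  by rewrite ler_wpM2l// ler_wpM2l// ler_pdivrMr// mulrC.
(* The averaged part of the weight yields twice the final rate; [H3] spends one half on the [da]
   term. *)
have H2 : al / (2 * T * K) * w * V <= - (2 * (k * V)).
  have -> : - (2 * (k * V)) = al / (2 * T * K) * (- al) * V.
    by rewrite kE; field; rewrite !gt_eqF.
  by rewrite ler_wpM2r// ler_wpM2l// divr_ge0 ?mulr_ge0// ltW.
have H3 : da * Mx <= k * V.
  rewrite (le_trans (ler_norm _))// normrM [`|Mx|]ger0_norm//.
  rewrite ler_pM// (le_trans MxX)// (le_trans _ Vc)//.
  by have := mulr_ge0 (ltW c20) X0; lra.
have H4 : - (a * p * S) <= al / 2 * X + au ^+ 2 * c ^+ 4 / (2 * al) * p ^+ 2.
  have c40 : 0 < c ^+ 4 by rewrite exprn_gt0.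
  (* AM-GM with weight [c^4 / al] *)
  have amgm : 0 <= al / (2 * c ^+ 4) * (S + a * p * c ^+ 4 / al) ^+ 2.
    by rewrite mulr_ge0 ?sqr_ge0// divr_ge0 ?mulr_ge0// ltW.
  have E : al / (2 * c ^+ 4) * (S + a * p * c ^+ 4 / al) ^+ 2 =
    al / (2 * c ^+ 4) * S ^+ 2 + a * p * S + a ^+ 2 * (c ^+ 4 / (2 * al) * p ^+ 2).
    by field; rewrite !gt_eqF.
  have S2 : al / (2 * c ^+ 4) * S ^+ 2 <= al / 2 * X.
    have -> : al / 2 * X = al / (2 * c ^+ 4) * (c ^+ 4 * X).
      by field; rewrite gt_eqF.
    by rewrite ler_wpM2l// divr_ge0 ?mulr_ge0// ltW.
  have a2 : a ^+ 2 * (c ^+ 4 / (2 * al) * p ^+ 2) <=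
      au ^+ 2 * (c ^+ 4 / (2 * al) * p ^+ 2).
    rewrite ler_wpM2r//; last by rewrite ler_pXn2r// nnegrE// ltW.
    by rewrite mulr_ge0 ?sqr_ge0// divr_ge0 ?mulr_ge0// ltW.
  move: amgm; rewrite E => amgm.
  have -> : au ^+ 2 * c ^+ 4 / (2 * al) * p ^+ 2 =
    au ^+ 2 * (c ^+ 4 / (2 * al) * p ^+ 2) by ring.
  lra.
have p2 : 0 <= c ^+ 2 * p ^+ 2 by rewrite mulr_ge0 ?sqr_ge0// ltW.
have q2 : 0 <= au ^+ 2 * c ^+ 4 / (2 * al) * p ^+ 2.
  by rewrite mulr_ge0 ?sqr_ge0// divr_ge0 ?mulr_ge0 ?exprn_ge0// ltW.
(* The three summands of [kap] at work: the first cancels [c * p ^+ 2], the second absorbs the AM-GM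
   remainder of [H4], and the third leaves a nonnegative surplus. *)
have kapp : 2 * kap * p ^+ 2 = c * p ^+ 2 +
    2 * (au ^+ 2 * c ^+ 4 / (2 * al) * p ^+ 2) + 2 * (c ^+ 2 * p ^+ 2).
  by rewrite kapE; field; rewrite gt_eqF.
have H5 : a * (al / 2 * X + (c * p ^+ 2 - A) - (2 * kap * p ^+ 2) +
    (- (a * p * S))) <= 0.
  rewrite mulr_ge0_le0//; lra.
have -> : (al / (2 * K) * a + al / (2 * T * K) * w) * V + da * Mx
    + a * (c * p ^+ 2 - A) - a * p * (2 * kap * p + a * S) =
  (al / (2 * K) * a * V - a * (al / 2 * X)) + al / (2 * T * K) * w * V + da * Mx +
   a * (al / 2 * X + (c * p ^+ 2 - A) - (2 * kap * p ^+ 2) + (- (a * p * S))).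
  by ring.
lra.
Qed.

(** * Algebra of bilinear forms *)

Definition dotp (R : realType) n (x y : 'cV[R]_n) : R :=
  \sum_i x i ord0 * y i ord0.

Section BilinearFormAlgebra.
Context {R : realType} {n : nat}.
Implicit Types (A B : 'I_n -> 'I_n -> R -> R) (x y u : 'cV[R]_n) (t k : R).

Lemma dotpC x y : dotp x y = dotp y x.
Proof. by apply: eq_bigr => i _; rewrite mulrC. Qed.

Lemma dotpxx x : dotp x x = enorm x ^+ 2.
Proof. by rewrite enorm_sqr; apply: eq_bigr => i _; rewrite expr2. Qed.

(** Cauchy-Schwarz, from the squared norm of [x] minus its projection on [u]. *)
Lemma sqr_dotp_unit u x : enorm u = 1 -> dotp u x ^+ 2 <= enorm x ^+ 2.
Proof.
move=> u1; have uu : dotp u u = 1 by rewrite dotpxx u1 expr1n.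
have : 0 <= \sum_i (x i ord0 - dotp u x * u i ord0) ^+ 2.
  by apply: sumr_ge0 => i _; exact: sqr_ge0.
rewrite (_ : \sum_i _ = dotp x x - dotp u x * (2 * dotp u x) +
    dotp u x ^+ 2 * dotp u u); last first.
  rewrite [X in _ * (2 * X)]/dotp [X in X - _ * _]/dotp [X in _ ^+ 2 * X]/dotp.
  rewrite !mulr_sumr -sumrN -!big_split/=; apply: eq_bigr => i _; ring.
by rewrite uu -dotpxx; lra.
Qed.

(** Since [bform] evaluates its coefficients at [t] only, freezing them at [t] loses nothing: the
    lemma also applies, by conversion, when [a] and [b] are values at [t] of time-dependent
    scalars. *)
Lemma bform_lin A B (a b : R) t x y :
  bform (fun i j _ => a * A i j t + b * B i j t) t x y =
  a * bform A t x y + b * bform B t x y.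
Proof.
rewrite /bform !mulr_sumr -big_split/=; apply: eq_bigr => i _.
by rewrite !mulr_sumr -big_split/=; apply: eq_bigr => j _; ring.
Qed.

Lemma bform_delta t x y :
  bform (fun i j _ => (i == j)%:R) t x y = dotp x y.
Proof.
apply: eq_bigr => i _; rewrite (bigD1 i)//= eqxx mul1r big1 ?addr0// => j ji.
by rewrite eq_sym (negbTE ji) mul0r.
Qed.

Lemma bform_rank1 (u : R -> 'cV[R]_n) t x y :
  bform (fun i j s => u s i ord0 * u s j ord0) t x y =
  dotp (u t) x * dotp (u t) y.
Proof.
rewrite /bform /dotp mulr_suml; apply: eq_bigr => i _.
by rewrite mulr_sumr; apply: eq_bigr => j _; ring.
Qed.

Lemma bformZr A t x y k : bform A t x (k *: y) = k * bform A t x y.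
Proof.
rewrite /bform mulr_sumr; apply: eq_bigr => i _; rewrite mulr_sumr.
by apply: eq_bigr => j _; rewrite !mxE; ring.
Qed.

Lemma bformZl A t x y k : bform A t (k *: x) y = k * bform A t x y.
Proof.
rewrite /bform mulr_sumr; apply: eq_bigr => i _; rewrite mulr_sumr.
by apply: eq_bigr => j _; rewrite !mxE; ring.
Qed.

Lemma bform_mulmx (P : 'M[R]_n) t x y :
  (x^T *m P *m y) ord0 ord0 = bform (fun i j _ => P i j) t x y.
Proof.
rewrite mxE /bform; under eq_bigr do rewrite mxE mulr_suml.
rewrite exchange_big/=; apply: eq_bigr => i _; apply: eq_bigr => j _.
by rewrite !mxE; ring.
Qed.

End BilinearFormAlgebra.

Lemma is_derive_rescale (R : realType) (F f : R -> R) (k t : R) :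
  (forall s : R, is_derive s 1 F (f s)) ->
  is_derive t 1 (fun s => F (s / k)) (f (t / k) / k).
Proof.
move=> Fd; have d : is_derive t 1 (fun s => s / k) k^-1.
  rewrite (_ : (fun s => s / k) = fun s => k^-1 * s); last first.
    by apply/funext => s; rewrite mulrC.
  apply: is_derive_eq (is_derive_funMl k^-1 (is_derive_id t 1)) _.
  by rewrite mulr1.
exact: (@is_derive1_comp _ F (fun s => s / k) t _ _ (Fd (t / k)) d).
Qed.

(** * The weighted quadratic form along the gradient system *)

Section GradientSystem.
Context {R : realType} {n : nat}.
Variables (T c al au : R) (h : R -> R) (m : R -> 'cV[R]_n) (alpha : R).
Hypotheses (T_gt0 : 0 < T) (c_gt0 : 0 < c) (al_gt0 : 0 < al) (au_gt0 : 0 < au).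
Hypothesis h_range : forall t, - au <= h t <= 0.
Hypothesis h_cont : continuous h.
Hypothesis h_der : forall t, derivable h t 1.
Hypothesis h_der_bounded : exists M, forall t, `|derive1 h t| <= M.
Hypothesis h_int :
  forall t, \int[lebesgue_measure]_(r in `[t - T, t]) h r <= - al.
Hypothesis m_cont : continuous m.
Hypothesis m_unit : forall t, enorm (m t) = 1.
Hypothesis m_int : forall t,
  loewner_le al%:M (mxintegral t (t + c) (fun r => m r *m (m r)^T)).
Hypothesis alpha_gt0 : 0 < alpha.
Hypothesis alpha_ge :
  2 * T * sup (range (fun r => `|derive1 h r|)) / cb c al au <= alpha.

Let kap := kappa c al au.
Let K := kap + c ^+ 2 * au.
Let k := cb c al au / (2 * T).
Let rho := alpha * al / (2 * T * K).
Let tau t := h (t / alpha).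
Let dtau t := derive1 h (t / alpha) / alpha.

Let mm i j t := m t i ord0 * m t j ord0.

Let mm_continuous i j : continuous (mm i j).
Proof.
by move=> t; apply: cvgM; apply: cvg_coord; exact: m_cont.
Qed.

Let c_ge0 : 0 <= c. Proof. exact: ltW. Qed.

Let kap_gt0 : 0 < kap.
Proof.
rewrite /kap /kappa addr_gt0 ?exprn_gt0// addr_gt0 ?divr_gt0//.
  by rewrite mulr_gt0 ?exprn_gt0.
by rewrite mulr_gt0.
Qed.

Let K_gt0 : 0 < K. Proof. by rewrite addr_gt0// mulr_gt0// exprn_gt0. Qed.

Let cb_gt0 : 0 < cb c al au.
Proof. by rewrite divr_gt0 ?exprn_gt0// mulr_gt0. Qed.

Let k_gt0 : 0 < k. Proof. by rewrite divr_gt0// mulr_gt0. Qed.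

Let rho_ge0 : 0 <= rho.
Proof. by rewrite ltW// divr_gt0 ?mulr_gt0. Qed.

(** This is where the lower bound on [alpha] enters: it says that the derivative of [h (t / alpha)]
    is at most [cb / (2 * T)] in size. Boundedness of [h'] guarantees that [sup] is an actual upper
    bound. *)
Let dtau_bound t : `|dtau t| <= k.
Proof.
have [B hB] := h_der_bounded.
have ub : `|derive1 h (t / alpha)| <= sup (range (fun r => `|derive1 h r|)).
  apply: ub_le_sup; last by exists (t / alpha).
  by exists B => _ [r _ <-]; exact: hB.
rewrite normrM [`|alpha^-1|]gtr0_norm ?invr_gt0// ler_pdivrMr//.
apply: (le_trans ub).
move: alpha_ge; rewrite ler_pdivrMr// => H.
rewrite -(@ler_pM2l _ (2 * T)) ?mulr_gt0//; apply: (le_trans H).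
by rewrite le_eqVlt /k; apply/orP; left; apply/eqP; field; rewrite gt_eqF.
Qed.

Section WithPrimitives.
Variables (H HH : R -> R) (G GG : 'I_n -> 'I_n -> R -> R).
Hypothesis Hd : forall t : R, is_derive t 1 H (h t).
Hypothesis HHd : forall t : R, is_derive t 1 HH (H t).
Hypothesis Gd : forall i j (t : R), is_derive t 1 (G i j) (mm i j t).
Hypothesis GGd : forall i j (t : R), is_derive t 1 (GG i j) (G i j t).

(** Closed forms through the primitives: [M] is the double integral in [Pmx], [E] the one in the
    exponent, [w] the integral of [h] over a window of length [T], [e] the exponential weight and
    [Q] the coefficients of [Vsharp]. *)
Let M i j t := c * G i j t - (GG i j t - GG i j (t - c)).
Let dM i j t := c * mm i j t - (G i j t - G i j (t - c)).
Let E u := T * H u - (HH u - HH (u - T)).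
Let w u := H u - H (u - T).
Let e t := expR (- (rho * E (t / alpha))).
Let de t := - (rho * ((T * h (t / alpha) - w (t / alpha)) / alpha)) * e t.
Let Q i j t := e t * kap * (i == j)%:R + - (e t * tau t) * M i j t.
(** The factor 1 gives the expression the shape of a nested [bform_lin]. *)
Let dQ i j t := de t * kap * (i == j)%:R +
  1 * (- (de t * tau t + e t * dtau t) * M i j t + - (e t * tau t) * dM i j t).

Let h_derive (t : R) : is_derive t 1 h (derive1 h t).
Proof. by split; [exact: h_der|rewrite derive1E]. Qed.

Let tau_derive (t : R) : is_derive t 1 tau (dtau t).
Proof. exact: (is_derive_rescale alpha t h_derive). Qed.

Let M_derive i j (t : R) : is_derive t 1 (M i j) (dM i j t).
Proof.
exact: (is_deriveB (is_derive_funMl c (Gd i j t))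
  (is_deriveB (GGd i j t) (is_derive_window c t (GGd i j)))).
Qed.

Let E_derive (u : R) : is_derive u 1 E (T * h u - w u).
Proof.
exact: (is_deriveB (is_derive_funMl T (Hd u))
  (is_deriveB (HHd u) (is_derive_window T u HHd))).
Qed.

Let e_derive (t : R) : is_derive t 1 e (de t).
Proof.
have d : is_derive t 1 (fun s => - (rho * E (s / alpha)))
    (- (rho * ((T * h (t / alpha) - w (t / alpha)) / alpha))).
  exact: (is_deriveN (is_derive_funMl rho (is_derive_rescale alpha t E_derive))).
by apply: is_derive_eq (is_derive1_comp (is_derive_expR _) d) _; rewrite mulrC.
Qed.

Let Q_derive i j (t : R) : is_derive t 1 (Q i j) (dQ i j t).
Proof.
have d : is_derive t 1 (fun s => - (e s * tau s)) (- (de t * tau t + e t * dtau t)).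
  exact: (is_deriveN (is_derive_funM (e_derive t) (tau_derive t))).
have d1 : is_derive t 1 (fun s => e s * kap * (i == j)%:R)
    (de t * kap * (i == j)%:R).
  rewrite (_ : (fun s => _) = fun s => kap * (i == j)%:R * e s); last first.
    by apply/funext => s; ring.
  by apply: is_derive_eq (is_derive_funMl _ (e_derive t)) _; ring.
apply: is_derive_eq (is_derive_funD d1 (is_derive_funM d (M_derive i j t))) _.
by rewrite /dQ; ring.
Qed.

Let dQ_continuous : continuous (derive1 h) -> forall i j, continuous (dQ i j).
Proof.
move=> h'c i j.
have cs (a : R) : continuous (fun s : R => s / a).
  by move=> t; apply: cvgM; [exact: cvg_id|exact: cvg_cst].
have ct (a : R) : continuous (fun s : R => s - a).
  by move=> t; apply: cvgB; [exact: cvg_id|exact: cvg_cst].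
have ec := is_derive_continuous e_derive.
have tauc := is_derive_continuous tau_derive.
have Mc := is_derive_continuous (M_derive i j).
have Hc := is_derive_continuous Hd.
have Gc := is_derive_continuous (Gd i j).
have comp_c (f g : R -> R) : continuous f -> continuous g ->
  continuous (fun s : R => f (g s)).
  by move=> fc gc t; exact: (continuous_comp (gc t) (fc _)).
have wc : continuous w.
  move=> t; apply: cvgB; first exact: Hc.
  exact: (comp_c _ _ Hc (ct T)).
have dec : continuous de.
  move=> t; apply: cvgM; last exact: ec.
  apply: cvgN; apply: cvgM; first exact: cvg_cst.
  apply: cvgM; last exact: cvg_cst.
  apply: cvgB; last exact: (comp_c _ _ wc (cs alpha)).
  by apply: cvgM; [exact: cvg_cst|exact: (comp_c _ _ h_cont (cs alpha))].
have dtauc : continuous dtau.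
  move=> t; apply: cvgM; last exact: cvg_cst.
  exact: (comp_c _ _ h'c (cs alpha)).
have dMc : continuous (dM i j).
  move=> t; apply: cvgB.
    by apply: cvgM; [exact: cvg_cst|exact: mm_continuous].
  by apply: cvgB; [exact: Gc|exact: (comp_c _ _ Gc (ct c))].
move=> t; apply: cvgD.
  apply: cvgM; last exact: cvg_cst.
  by apply: cvgM; [exact: dec|exact: cvg_cst].
apply: cvgM; first exact: cvg_cst.
apply: cvgD; apply: cvgM; [|exact: Mc| |exact: dMc]; apply: cvgN.
- by apply: cvgD; apply: cvgM; [exact: dec|exact: tauc|exact: ec|exact: dtauc].
- by apply: cvgM; [exact: ec|exact: tauc].
Qed.

Let Vsharp_bform : Vsharp T c al au h m alpha = fun x t => bform Q t x x.
Proof.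
apply/funext => x; apply/funext => t.
rewrite /Vsharp (window_double_Rintegral _ h_cont (ltW T_gt0) Hd HHd).
rewrite -/(E _) -/kap -/K -/rho -/(e t) /Vfun (bform_mulmx _ t).
rewrite /bform mulr_sumr; apply: eq_bigr => i _; rewrite mulr_sumr.
apply: eq_bigr => j _; rewrite !mxE.
rewrite (_ : Rintegral _ _ _ = M i j t); last first.
  rewrite /M -(window_double_Rintegral t (@mm_continuous i j) c_ge0 (Gd i j)
    (GGd i j)).
  apply: eq_Rintegral => s _; rewrite mxE.
  by apply: eq_Rintegral => l _; rewrite !mxE big_ord1 !mxE.
rewrite -mulr_natr /Q /tau -/kap; ring.
Qed.

Let bform_M t x y : bform M t x y =
  c * bform G t x y - (bform GG t x y - bform GG (t - c) x y).
Proof.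
rewrite /bform mulr_sumr -!sumrB; apply: eq_bigr => i _.
rewrite mulr_sumr -!sumrB; apply: eq_bigr => j _.
by rewrite /M; ring.
Qed.

Let bform_dM t x : bform dM t x x =
  c * dotp (m t) x ^+ 2 - (bform G t x x - bform G (t - c) x x).
Proof.
rewrite expr2 -bform_rank1 /bform mulr_sumr -!sumrB; apply: eq_bigr => i _.
rewrite mulr_sumr -!sumrB; apply: eq_bigr => j _.
by rewrite /dM /mm; ring.
Qed.

Let bform_Q t x y : bform Q t x y =
  e t * kap * dotp x y + - (e t * tau t) * bform M t x y.
Proof. by rewrite -(bform_delta t); exact: bform_lin. Qed.

Let bform_dQ t x : bform dQ t x x =
  de t * kap * enorm x ^+ 2 + 1 * (- (de t * tau t + e t * dtau t) * bform M t x x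
    + - (e t * tau t) * bform dM t x x).
Proof.
rewrite -dotpxx -(bform_delta t) -(bform_lin M dM) -(bform_lin _ _ (de t * kap) 1).
by [].
Qed.

Let bform_G_derive x y (s : R) : is_derive s 1 (fun r => bform G r x y)
  (dotp (m s) x * dotp (m s) y).
Proof.
by rewrite -bform_rank1; apply: is_derive_bform_time => i j; exact: Gd.
Qed.

Let bform_GG_derive x y (s : R) : is_derive s 1 (fun r => bform GG r x y)
  (bform G s x y).
Proof. by apply: is_derive_bform_time => i j; exact: GGd. Qed.

(** For fixed [x] and [y], [bform G] and [bform GG] are first and second primitives of the scalar
    function [dotp (m s) x * dotp (m s) y], so the window bounds apply. *)
Let bform_M_abs x y t (B : R) :
  (forall s, `|dotp (m s) x * dotp (m s) y| <= B) ->
  `|bform M t x y| <= B * c ^+ 2 / 2.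
Proof.
move=> fB; rewrite bform_M ler_norml; apply/andP; split.
  rewrite -2!mulNr; apply: (window_ge t c_ge0 (bform_G_derive x y)
    (bform_GG_derive x y)) => s.
  by have := fB s; rewrite ler_norml => /andP[].
apply: (window_le t c_ge0 (bform_G_derive x y) (bform_GG_derive x y)) => s.
by have := fB s; rewrite ler_norml => /andP[].
Qed.

Let dotp_abs t x : `|dotp (m t) x| <= enorm x.
Proof.
rewrite -(@ler_pXn2r _ 2) ?nnegrE ?enorm_ge0//.
by rewrite -normrX ger0_norm ?sqr_ge0// sqr_dotp_unit.
Qed.

Let bform_Mxx_ge0 t x : 0 <= bform M t x x.
Proof.
rewrite bform_M; have := @window_ge R _ _ _ 0 c t c_ge0 (bform_G_derive x x)
  (bform_GG_derive x x).
by rewrite !mul0r; apply => s; rewrite -expr2 sqr_ge0.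
Qed.

Let bform_Mxx_le t x : bform M t x x <= c ^+ 2 / 2 * enorm x ^+ 2.
Proof.
apply: (le_trans (ler_norm _)).
rewrite (_ : _ * _ = enorm x ^+ 2 * c ^+ 2 / 2); last by ring.
apply: bform_M_abs => s; rewrite normrM expr2.
by rewrite ler_pM.
Qed.

Let bform_Mxm_abs t x u : enorm u = 1 ->
  `|bform M t x u| <= enorm x * c ^+ 2 / 2 /\
  `|bform M t u x| <= enorm x * c ^+ 2 / 2.
Proof.
move=> u1; split; apply: bform_M_abs => s; rewrite normrM.
  by rewrite -[leRHS]mulr1 ler_pM// -u1.
by rewrite -[leRHS]mul1r ler_pM// -u1.
Qed.

(** Each cross term integrates a function of size at most [enorm x] over a triangle of area
    [c ^+ 2 / 2]; their sum is at most [enorm x * c ^+ 2]. *)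
Let cross_le t x : (bform M t x (m t) + bform M t (m t) x) ^+ 2 <=
  c ^+ 4 * enorm x ^+ 2.
Proof.
have [H1 H2] := bform_Mxm_abs t x (m_unit t).
rewrite (_ : _ * _ = (enorm x * c ^+ 2) ^+ 2); last by ring.
rewrite -[X in X <= _]real_normK ?num_real//.
rewrite ler_pXn2r ?nnegrE ?mulr_ge0 ?enorm_ge0 ?exprn_ge0//.
by rewrite (le_trans (ler_normD _ _))// (le_trans (lerD H1 H2))//; lra.
Qed.

(** Persistent excitation of [m] over the window that ends at [t]. *)
Let excitation t x :
  al * enorm x ^+ 2 <= bform G t x x - bform G (t - c) x x.
Proof.
have [_ /(_ x)] := m_int (t - c); rewrite subrK (bform_mulmx _ t) => H0.
rewrite -subr_ge0; apply: (le_trans H0); rewrite le_eqVlt; apply/orP; left.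
apply/eqP; rewrite -dotpxx -(bform_delta t) /bform mulr_sumr -!sumrB.
apply: eq_bigr => i _; rewrite mulr_sumr -!sumrB; apply: eq_bigr => j _.
rewrite !mxE (_ : Rintegral _ _ _ = G i j t - G i j (t - c)).
  by rewrite -mulr_natr; ring.
rewrite -(Rintegral_FTC (@mm_continuous i j) (Gd i j)) ?gerBl//.
by apply: eq_Rintegral => l _; rewrite !mxE big_ord1 !mxE.
Qed.

Let tau_le0 t : tau t <= 0. Proof. by have /andP[] := h_range (t / alpha). Qed.

Let tau_ge t : - tau t <= au.
Proof. by rewrite lerNl; have /andP[] := h_range (t / alpha). Qed.

Let V x t := kap * enorm x ^+ 2 + - tau t * bform M t x x.

Let bform_Qxx x t : bform Q t x x = e t * V x t.
Proof. by rewrite bform_Q dotpxx /V; ring. Qed.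

Let V_ge x t : kap * enorm x ^+ 2 <= V x t.
Proof. by rewrite lerDl mulr_ge0// oppr_ge0. Qed.

Let V_le x t : V x t <= K * enorm x ^+ 2.
Proof.
have -> : K * enorm x ^+ 2 = kap * enorm x ^+ 2 + c ^+ 2 * au * enorm x ^+ 2.
  by rewrite /K; ring.
rewrite lerD2l.
have c2 : 0 <= c ^+ 2 * au * enorm x ^+ 2.
  by rewrite mulr_ge0 ?sqr_ge0// mulr_ge0 ?sqr_ge0// ltW.
apply: (@le_trans _ _ (au * (c ^+ 2 / 2 * enorm x ^+ 2))); last by lra.
by rewrite ler_pM// oppr_ge0.
Qed.

(** The sign of [h] makes the exponent of the weight nonnegative. With the lower bound on [h], the
    weight stays between 1 and [e_max], so it does not affect the quadratic growth of the form. *)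
Let E_le0 u : E u <= 0.
Proof.
have := @window_le R _ _ _ 0 T u (ltW T_gt0) Hd HHd.
by rewrite !mul0r; apply => s; have /andP[] := h_range s.
Qed.

Let E_ge u : - (au * T ^+ 2 / 2) <= E u.
Proof.
rewrite -2!mulNr; apply: (window_ge u (ltW T_gt0) Hd HHd) => s.
by have /andP[] := h_range s.
Qed.

Let e_ge1 t : 1 <= e t.
Proof. by rewrite -expR0 ler_expR oppr_ge0 mulr_ge0_le0. Qed.

Let e_max := expR (rho * (au * T ^+ 2 / 2)).

Let e_le t : e t <= e_max.
Proof. by rewrite ler_expR -mulrN ler_wpM2l// lerNl. Qed.

(** The velocity is along [m t], so the state derivative of the form only involves [dotp (m t) x]
    and the cross terms of [M] with [m t]. *)
Let sys_fieldE x t :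
  sys_field h m alpha x t = (tau t * dotp (m t) x) *: m t.
Proof.
apply/colP => i; rewrite !mxE -mulrA; congr (_ * _).
rewrite /dotp mulr_suml; apply: eq_bigr => j _.
by rewrite !mxE big_ord1 !mxE; ring.
Qed.

Let Q_decay x t :
  bform dQ t x x + (bform Q t x (sys_field h m alpha x t)
    + bform Q t (sys_field h m alpha x t) x) <= - (k * bform Q t x x).
Proof.
rewrite sys_fieldE bformZr bformZl bform_dQ bform_dM !bform_Q dotpxx.
rewrite (dotpC x (m t)).
set p := dotp (m t) x; set A := bform G t x x - _.
set S1 := bform M t x (m t); set S2 := bform M t (m t) x.
set X := enorm x ^+ 2; set Mx := bform M t x x.
have wal : w (t / alpha) <= - al.
  have Tle : t / alpha - T <= t / alpha by rewrite gerBl ltW.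
  by rewrite /w -(Rintegral_FTC h_cont Hd Tle).
have X0 : 0 <= X by exact: sqr_ge0.
have a0 : 0 <= - tau t by rewrite oppr_ge0.
have dk : `|- dtau t| <= k by rewrite normrN.
have kE : k = al ^+ 2 / (2 * K) / (2 * T) by [].
(* The weight [e t] factors out of both sides. The quotient [de t / e t] is the coefficient of [V]
   in the inequality, with [a = - tau t] and [w] taken at [t / alpha]. *)
have := lyapunov_decay_inequality p T_gt0 c_gt0 al_gt0 au_gt0 X0
  (erefl kap) (erefl K) kE a0 (tau_ge t) (bform_Mxx_ge0 t x) (bform_Mxx_le t x)
  (cross_le t x) (excitation t x) dk wal (erefl (V x t)).
rewrite -/p -/A -/S1 -/S2 -/X -/Mx => Hineq.
have e0 : 0 <= e t by exact: expR_ge0.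
have := ler_wpM2l e0 Hineq.
have -> : - (k * (e t * kap * X + - (e t * tau t) * Mx)) = e t * - (k * V x t).
  by rewrite /V -/X -/Mx; ring.
apply: le_trans; rewrite le_eqVlt; apply/orP; left; apply/eqP.
rewrite /V -/X -/Mx /de /tau /rho; field.
by rewrite !gt_eqF.
Qed.

Let Q_bounds x t : kap * enorm x ^+ 2 <= bform Q t x x <= K * e_max * enorm x ^+ 2.
Proof.
have X0 : 0 <= enorm x ^+ 2 := sqr_ge0 _.
have kX0 : 0 <= kap * enorm x ^+ 2 by rewrite mulr_ge0// ltW.
have V0 := le_trans kX0 (V_ge x t).
rewrite bform_Qxx; apply/andP; split.
  by rewrite (le_trans (V_ge x t))// ler_peMl.
rewrite (_ : K * e_max * _ = e_max * (K * enorm x ^+ 2)); last by ring.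
by apply: ler_pM => //; exact: expR_ge0.
Qed.

Let estimates : lyapunov_estimates (sys_field h m alpha)
  (Vsharp T c al au h m alpha).
Proof.
rewrite Vsharp_bform; split.
  move=> x t _; have /andP[+ _] := Q_bounds x t; apply: le_trans.
  by rewrite mulr_ge0 ?sqr_ge0// ltW.
(* The first two come from [Q_bounds]; the third combines the decay rate [k] with the lower bound of
   the form. *)
exists (fun s => kap * s ^+ 2), (fun s => K * e_max * s ^+ 2),
  (fun s => k * kap * s ^+ 2).
have kk0 : 0 < k * kap by rewrite mulr_gt0.
split.
- exact: class_Kinfty_sqr.
- by apply: class_Kinfty_sqr; rewrite mulr_gt0// expR_gt0.
- have [kc _ _ _] := class_Kinfty_sqr kk0; split => //.
    by move=> s _; rewrite mulr_ge0 ?sqr_ge0// ltW.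
  move=> s _; split=> [/eqP|->]; last by rewrite expr0n mulr0.
  by rewrite mulf_eq0 gt_eqF//= sqrf_eq0 => /eqP.
- move=> x t t0; split; first exact: Q_bounds.
  rewrite (gradt_bform Q_derive)// gradx_bform_mul (le_trans (Q_decay x t))//.
  rewrite lerN2 -mulrA ler_wpM2l ?(ltW k_gt0)//.
  by have /andP[] := Q_bounds x t.
Qed.

(** The field is linear with bounded coefficients: entries of [m t] are at most 1 in size, so row
    sums are at most [n] times [au]. Convergence of the quotients is checked by coordinates. *)
Let trajectories_exist xo to :
  exists phi, trajectory (sys_field h m alpha) `[to, +oo[ to xo phi.
Proof.
have Ac i j : continuous (fun t => tau t * mm i j t).
  move=> t; apply: cvgM; last exact: mm_continuous.
  exact: (is_derive_continuous tau_derive).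
have m_le i t : `|m t i ord0| <= 1.
  rewrite -(m_unit t) -(@ler_pXn2r _ 2) ?nnegrE ?enorm_ge0//.
  rewrite enorm_sqr real_normK ?num_real// (bigD1 i)//= lerDl.
  by apply: sumr_ge0 => l _; exact: sqr_ge0.
have AL i t : \sum_j `|tau t * mm i j t| <= au *+ n.
  have -> : au *+ n = \sum_(j < n) au by rewrite sumr_const card_ord.
  apply: ler_sum => j _; rewrite normrM ler0_norm//.
  by rewrite -[leRHS]mulr1 ler_pM ?oppr_ge0// normrM -[leRHS]mulr1 ler_pM.
have [psi [psio psid]] :=
  @linear_ode_exists R n _ _ to xo Ac (mulrn_wge0 n (ltW au_gt0)) AL.
exists psi; split => // t; rewrite /= in_itv/= andbT => tot.
have pf : Filter (within (fun s => [set` `[to, +oo[] (t + s)) (0 : R)^').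
  exact: within_filter.
apply: cvg_mx => i j; rewrite (ord1 j).
rewrite (_ : (fun s => _) =
    fun s : R => s^-1 *: (psi (t + s) i ord0 - psi t i ord0)); last first.
  by apply/funext => s; rewrite !mxE.
have := @is_derive_quotients_within R R [set` `[to, +oo[] _ _ _ (psid t tot i).
rewrite (_ : \sum_j _ = sys_field h m alpha (psi t) t i ord0)//.
rewrite sys_fieldE mxE /dotp mulr_sumr mulr_suml; apply: eq_bigr => l _.
by rewrite /mm; ring.
Qed.

Lemma lyapunov_of_primitives :
  [/\ continuous (derive1 h) ->
        lyapunov_function (sys_field h m alpha) (Vsharp T c al au h m alpha),
      has_partials (Vsharp T c al au h m alpha),
      lyapunov_estimates (sys_field h m alpha) (Vsharp T c al au h m alpha)
    & UGAS (sys_field h m alpha)].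
Proof.
split; last 2 first.
- exact: estimates.
- apply: (@quadratic_UGAS R n Q dQ _ k Q_derive (fun x t _ => Q_decay x t) kap
    (K * e_max)) => //.
  + rewrite (@le_trans _ _ K)//.
      by rewrite lerDl mulr_ge0 ?sqr_ge0// ltW.
    by rewrite ler_peMr ?(ltW K_gt0)// (le_trans (e_ge1 0)).
- move=> h'c; split; last exact: estimates.
  by rewrite Vsharp_bform; exact: C1_bform Q_derive (dQ_continuous h'c).
- by rewrite Vsharp_bform; exact: has_partials_bform Q_derive.
Qed.

End WithPrimitives.
End GradientSystem.

Theorem theorem18 (R : realType) (n : nat) (T c al au : R)
    (h : R -> R) (m : R -> 'cV[R]_n)
    (T_gt0 : 0 < T) (c_gt0 : 0 < c) (al_gt0 : 0 < al) (au_gt0 : 0 < au)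
    (h_range : forall t, - au <= h t <= 0)
    (h_cont : continuous h)
    (h_der : forall t, derivable h t 1)
    (h_der_bounded : exists M, forall t, `|derive1 h t| <= M)
    (h_int : forall t, \int[lebesgue_measure]_(r in `[t - T, t]) h r <= - al)
    (m_cont : continuous m)
    (m_unit : forall t, enorm (m t) = 1)
    (m_int : forall t,
       loewner_le al%:M (mxintegral t (t + c) (fun r => m r *m (m r)^T)) /\
       loewner_le (mxintegral t (t + c) (fun r => m r *m (m r)^T)) au%:M)
    (alpha : R) (alpha_gt0 : 0 < alpha)
    (alpha_ge : 2 * T * sup (range (fun r => `|derive1 h r|)) / cb c al au
                  <= alpha) :
  (* V^sharp is C^1, as a Lyapunov function must be, only when h' is
     continuous; everything else holds without that. *)
  [/\ continuous (derive1 h) ->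
        lyapunov_function (sys_field h m alpha) (Vsharp T c al au h m alpha),
      has_partials (Vsharp T c al au h m alpha),
      lyapunov_estimates (sys_field h m alpha) (Vsharp T c al au h m alpha)
    & UGAS (sys_field h m alpha)].
Proof.
have [H [Hd _]] := primitive_exists h_cont.
have [HH [HHd _]] := primitive_exists (is_derive_continuous Hd).
(* Pairs of indices allow one application of [choice] to produce the whole family of primitives. *)
have mmc (ij : 'I_n * 'I_n) :
    continuous (fun t => m t ij.1 ord0 * m t ij.2 ord0).
  by move=> t; apply: cvgM; apply: cvg_coord; exact: m_cont.
have [G GP] := choice (fun ij => primitive_exists (mmc ij)).
have [GG GGP] := choice
  (fun ij => primitive_exists (is_derive_continuous (GP ij).1)).
exact: (lyapunov_of_primitives T_gt0 c_gt0 al_gt0 au_gt0 h_range h_cont h_der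
  h_der_bounded h_int m_cont m_unit (fun t => (m_int t).1) alpha_gt0 alpha_ge
  Hd HHd (fun i j => (GP (i, j)).1) (fun i j => (GGP (i, j)).1)).
Qed.
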